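(* Let $K$ be a totally real number field of degree $n$ with ring of integers $\mathcal{O}$, and let $\Gamma=\mathrm{SL}_2(\mathcal{O})$. For any sequence of nonzero ideals $I$ of $\mathcal{O}$ with $\mathrm{N}(I)\to\infty$, all but finitely many members $I$ of the sequence satisfy $$\mathrm{sys}\,\pi_1(M_I)\ \le\ 4n^{3/2}\log\big([\Gamma:\Gamma(I)]\big),$$ where $\Gamma(I)$ is the principal congruence subgroup of $\Gamma$ associated to $I$ and $M_I=(\mathbb{H}^2)^n/\Gamma(I)$.
   Context: $\mathbb{H}^2$ is the hyperbolic plane (upper half-plane model, curvature $-1$), on which $\mathrm{SL}_2(\mathbb{R})$ acts by fractional linear transformations. $(\mathbb{H}^2)^n$ carries the product Riemannian metric, so its distance is $d(z,w)=\big(\sum_{i=1}^n d_{\mathbb{H}^2}(z_i,w_i)^2\big)^{1/2}$, and $(\mathrm{SL}_2(\mathbb{R}))^n$ acts on it factor by factor. Let $\sigma_1,\dots,\sigma_n:K\to\mathbb{R}$ be the $n$ real embeddings of $K$. The group $\Gamma=\mathrm{SL}_2(\mathcal{O})$ acts on $(\mathbb{H}^2)^n$ via $A\mapsto(\sigma_1(A),\dots,\sigma_n(A))$, where $\sigma_i(A)$ is obtained by applying $\sigma_i$ to the entries of $A$. For a nonzero ideal $I\subset\mathcal{O}$, $\mathrm{N}(I)=|\mathcal{O}/I|$ and $\Gamma(I)=\ker\big(\mathrm{SL}_2(\mathcal{O})\to\mathrm{SL}_2(\mathcal{O}/I)\big)$, a finite-index normal subgroup of $\Gamma$. When $\Gamma(I)$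 acts freely on $(\mathbb{H}^2)^n$ (which is the case when $\mathrm{N}(I)$ is sufficiently large), $M_I=(\mathbb{H}^2)^n/\Gamma(I)$ is a Riemannian manifold with the metric induced from $(\mathbb{H}^2)^n$. The systole $\mathrm{sys}\,\pi_1(M)$ of a Riemannian manifold $M$ is the least length of a non-contractible closed geodesic in $M$. *)

(* Defs.v *)
From HB Require Import structures.
From mathcomp Require Import all_boot all_order all_algebra all_field.
From mathcomp Require Import finmap ring complex.
From mathcomp Require Import all_classical all_reals all_analysis.

Set Implicit Arguments.
Unset Strict Implicit.
Unset Printing Implicit Defensive.

Import Order.TTheory GRing.Theory Num.Theory.
Import numFieldNormedType.Exports.

Local Open Scope classical_set_scope.
Local Open Scope ring_scope.
Local Open Scope quotient_scope.
Local Open Scope complex_scope.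

Definition totally_real (R : realType) (K : fieldExtType rat) : Prop :=
  forall (f : {rmorphism K -> R[i]}) (x : K), complex.Im (f x) = 0.

Definition real_embeddings (R : realType) (K : fieldExtType rat) (n : nat)
    (sigma : 'I_n -> {rmorphism K -> R}) : Prop :=
  (forall i j, sigma i =1 sigma j -> i = j) /\
  (forall f : {rmorphism K -> R}, exists i, f =1 sigma i).

Definition int_closure (K : fieldExtType rat) : {pred K} :=
  [pred x : K | `[< integralOver (intr : int -> K) x >]].
Arguments int_closure K : clear implicits.

Lemma int_closure_subring (K : fieldExtType rat) :
  subring_closed (int_closure K).
Proof.
split=> [|x y /asboolP hx /asboolP hy|x y /asboolP hx /asboolP hy].
- by apply/asboolP; exact: (integral1 (intr : {rmorphism int -> K})).
- by apply/asboolP; exact: integral_sub.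
- by apply/asboolP; exact: integral_mul.
Qed.

HB.instance Definition _ (K : fieldExtType rat) :=
  GRing.isSubringClosed.Build K (int_closure K) (@int_closure_subring K).

Record ringOfIntegers (K : fieldExtType rat) := RingOfIntegers {
  integer_val :> K;
  _ : integer_val \in int_closure K
}.

HB.instance Definition _ K := [isSub for @integer_val K].
HB.instance Definition _ K := [Choice of ringOfIntegers K by <:].
HB.instance Definition _ K :=
  [SubChoice_isSubComNzRing of ringOfIntegers K by <:].

(* The library's [idealr] only covers proper ideals; the unit ideal is
   allowed here. *)
Record ideal (A : comNzRingType) := Ideal {
  ideal_set :> A -> Prop;
  ideal0 : ideal_set 0;
  idealD : forall x y, ideal_set x -> ideal_set y -> ideal_set (x + y);
  idealM : forall a x, ideal_set x -> ideal_set (a * x)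
}.

Definition nonzero_ideal (A : comNzRingType) (I : ideal A) : Prop :=
  exists2 x, I x & x != 0.

(* The number of classes modulo [I]; [fset_set] sends an infinite set to the
   empty one, but O/I is finite for a nonzero ideal I of a ring of integers. *)
Definition ideal_norm (A : comNzRingType) (I : ideal A) : nat :=
  #|` fset_set [set [set x + y | y in ideal_set I] | x in [set: A]]|.

Definition SL2 (A : comNzRingType) := {M : 'M[A]_2 | \det M == 1}.

HB.instance Definition _ (A : comNzRingType) := Choice.on (SL2 A).

Section SL2Group.
Variable A : comNzRingType.
Implicit Types M N : SL2 A.

Lemma SL2_one_subproof : \det (1%:M : 'M[A]_2) == 1.
Proof. by rewrite det1. Qed.

Lemma SL2_mul_subproof M N : \det (val M *m val N) == 1.
Proof. by rewrite det_mulmx (eqP (valP M)) (eqP (valP N)) mulr1. Qed.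

Lemma SL2_inv_subproof M : \det (\adj (val M)) == 1.
Proof.
have := congr1 determinant (mul_mx_adj (val M)).
by rewrite det_mulmx (eqP (valP M)) det1 mul1r => ->.
Qed.

Definition SL2_one : SL2 A := exist _ 1%:M SL2_one_subproof.
Definition SL2_mul M N : SL2 A := exist _ (val M *m val N) (SL2_mul_subproof M N).
Definition SL2_inv M : SL2 A := exist _ (\adj (val M)) (SL2_inv_subproof M).

Lemma SL2_mulA : associative SL2_mul.
Proof. by move=> M N P; apply: val_inj; exact: mulmxA. Qed.

Lemma SL2_mul1 : left_id SL2_one SL2_mul.
Proof. by move=> M; apply: val_inj; exact: mul1mx. Qed.

Lemma SL2_mulr1 : right_id SL2_one SL2_mul.
Proof. by move=> M; apply: val_inj; exact: mulmx1. Qed.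

Lemma SL2_mulV : left_inverse SL2_one SL2_inv SL2_mul.
Proof.
by move=> M; apply: val_inj; rewrite /= mul_adj_mx (eqP (valP M)).
Qed.

Lemma SL2_mulrV : right_inverse SL2_one SL2_inv SL2_mul.
Proof.
by move=> M; apply: val_inj; rewrite /= mul_mx_adj (eqP (valP M)).
Qed.

HB.instance Definition _ := isGroup.Build (SL2 A)
  SL2_mulA SL2_mul1 SL2_mulr1 SL2_mulV SL2_mulrV.

End SL2Group.

Lemma SL2_map_subproof (A B : comNzRingType) (f : {rmorphism A -> B})
  (M : SL2 A) : \det (map_mx f (val M)) == 1.
Proof. by rewrite det_map_mx (eqP (valP M)) rmorph1. Qed.

Definition SL2_map (A B : comNzRingType) (f : {rmorphism A -> B}) (M : SL2 A) :
  SL2 B := exist _ (map_mx f (val M)) (SL2_map_subproof f M).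

(* M is in the kernel of SL_2(A) -> SL_2(A/I) iff M is congruent to the
   identity matrix modulo I. *)
Definition congruence_subgroup (A : comNzRingType) (I : ideal A) :
    set (SL2 A) :=
  [set M : SL2 A | forall i j, I (val M i j - (1%:M : 'M[A]_2) i j)].

(* The number of left cosets, with the convention of [ideal_norm] for infinite
   sets. *)
Definition group_index (G : groupType) (H : set G) : nat :=
  #|` fset_set [set [set (g * h)%g | h in H] | g in [set: G]]|.

Record upper_half_plane (R : realType) := UpperHalfPlane {
  uhp_val :> R[i];
  _ : 0 < complex.Im uhp_val
}.

HB.instance Definition _ R := [isSub for @uhp_val R].
HB.instance Definition _ R := [Choice of upper_half_plane R by <:].

Definition uhp_coord (R : realType) (z : upper_half_plane R) : R * R :=
  (complex.Re z, complex.Im z).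

HB.instance Definition _ (R : realType) :=
  Topological.copy (upper_half_plane R) (initial_topology (@uhp_coord R)).

Definition mobius (R : realType) (M : 'M[R]_2) (z : R[i]) : R[i] :=
  ((M 0 0)%:C * z + (M 0 1)%:C) / ((M 1 0)%:C * z + (M 1 1)%:C).

Lemma det2 (A : comNzRingType) (M : 'M[A]_2) :
  \det M = M 0 0 * M 1 1 - M 0 1 * M 1 0.
Proof.
rewrite (expand_det_row _ 0) !big_ord_recl big_ord0 addr0 /cofactor !det_mx11.
rewrite !mxE /= expr0 mul1r expr1 mulN1r mulrN.
by congr (M _ _ * M _ _ - M _ _ * M _ _); apply: val_inj.
Qed.

Lemma mobius_den_neq0 (R : realType) (M : SL2 R) (z : upper_half_plane R) :
  ((val M 1 0)%:C * uhp_val z + (val M 1 1)%:C != 0)%R.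
Proof.
case: z => [[x y] /= y0]; rewrite eq_complex /= !mul0r subr0 !addr0.
apply/negP => /andP[/eqP h1]; rewrite mulf_eq0 (gt_eqF y0) orbF => /eqP c0.
have := eqP (valP M); rewrite det2 c0 mulr0 subr0.
move: h1; rewrite c0 mul0r add0r => ->.
by rewrite mulr0 => /esym/eqP; rewrite oner_eq0.
Qed.

Lemma mobius_Im_gt0 (R : realType) (M : SL2 R) (z : upper_half_plane R) :
  0 < complex.Im (mobius (val M) z).
Proof.
have := mobius_den_neq0 M z; have := eqP (valP M); rewrite det2 /mobius.
case: z => [[x y] /= y0].
move: (val M 0 0) (val M 0 1) (val M 1 0) (val M 1 1) => a b c d dt.
rewrite eq_complex /= !mul0r !subr0 !addr0 => den0.
set n2 := _ ^+ 2 + _ ^+ 2.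
have n2_gt0 : 0 < n2.
  rewrite lt_def addr_ge0 ?sqr_ge0 // andbT paddr_eq0 ?sqr_ge0 //.
  by rewrite !sqrf_eq0.
suff -> : (a * x + b) * - (c * y / n2) + a * y * ((c * x + d) / n2) = y / n2.
  exact: divr_gt0.
have -> : y / n2 = (a * d - b * c) * y / n2 by rewrite dt mul1r.
by field; rewrite gt_eqF.
Qed.

Definition uhp_act (R : realType) (M : SL2 R) (z : upper_half_plane R) :
  upper_half_plane R := UpperHalfPlane (mobius_Im_gt0 M z).

Lemma uhp_act1 (R : realType) (z : upper_half_plane R) : uhp_act 1%g z = z.
Proof.
apply: val_inj; rewrite /= /mobius !mxE /=.
by rewrite mul1r mul0r addr0 add0r divr1.
Qed.

Lemma uhp_actM (R : realType) (M N : SL2 R) (z : upper_half_plane R) :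
  uhp_act (M * N)%g z = uhp_act M (uhp_act N z).
Proof.
apply: val_inj; rewrite /= /mobius.
have d1 := mobius_den_neq0 N z.
have d2 := mobius_den_neq0 M (uhp_act N z).
have d3 := mobius_den_neq0 (M * N)%g z.
move: d1 d2 d3; rewrite /= /mobius !mxE !big_ord_recl !big_ord0 !addr0.
rewrite !rmorphD !rmorphM /= (_ : lift ord0 ord0 = 1); last exact: val_inj.
rewrite (_ : ord0 = 0) //.
move: (uhp_val z) => {}z.
move: (val M 0 0)%:C (val M 0 1)%:C (val M 1 0)%:C (val M 1 1)%:C => a b c d.
move: (val N 0 0)%:C (val N 0 1)%:C (val N 1 0)%:C (val N 1 1)%:C => e f g h.
move=> d1 d2 d3; field; rewrite d1 /=.
by apply: contraNN d3 => /eqP <-; apply/eqP; ring.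
Qed.

Definition arcosh (R : realType) (x : R) : R :=
  ln (x + Num.sqrt (x ^+ 2 - 1)).

(* Closed form of the distance of the metric (dx^2 + dy^2) / y^2. *)
Definition uhp_dist (R : realType) (z w : upper_half_plane R) : R :=
  arcosh (1 + Normc.normc (uhp_val z - uhp_val w) ^+ 2 /
              (2 * complex.Im z * complex.Im w)).

(* Points of the product are row vectors, which carry the product topology. *)
Definition prod_dist (R : realType) (n : nat)
    (z w : 'rV[upper_half_plane R]_n) : R :=
  Num.sqrt (\sum_(i < n) uhp_dist (z 0 i) (w 0 i) ^+ 2).

Section Systole.
Context {R : realType} {T : topologicalType}.
Variable dist : T -> T -> R.
Implicit Types c : R -> T.

(* A closed curve is a 1-periodic map, i.e. a map R/Z -> T. *)
Definition closed_curve c : Prop := forall t, c (t + 1) = c t.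

(* A geodesic is a curve of constant speed [v] realizing the distance between
   any two nearby points on it; for the Riemannian distance of a manifold these
   are the Riemannian geodesics. *)
Definition geodesic c : Prop :=
  exists2 v : R, 0 <= v &
    forall t : R, \forall x & y \near t, dist (c x) (c y) = v * `|x - y|.

Definition variation_dist (a b : R) c (s : seq R) : R :=
  let F := c \o nth b (a :: s) in
  \sum_(0 <= k < size s) dist (F k) (F k.+1).

(* The length of a curve is the supremum of the lengths of inscribed chains. *)
Definition curve_length (a b : R) c : \bar R :=
  ereal_sup [set (variation_dist a b c s)%:E | s in itv_partition a b].

(* Free homotopy of closed curves to a constant curve. *)
Definition contractible c : Prop :=
  exists (h : R * R -> T) (p : T),
    [/\ {within `[0, 1] `*` setT, continuous h},
        forall t, h (0, t) = c t,
        forall t, h (1, t) = p &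
        forall s, s \in `[0, 1] -> closed_curve (fun t => h (s, t))].

(* The least length is taken as an infimum in the extended reals, so that it is
   +oo in the absence of non-contractible closed geodesics. *)
Definition systole : \bar R :=
  ereal_inf [set curve_length 0 1 c | c in
    [set c | [/\ closed_curve c, geodesic c & ~ contractible c]]].

End Systole.

Section Quotient.
Context {R : realType} {K : fieldExtType rat} {n : nat}.
Variable sigma : 'I_n -> {rmorphism K -> R}.
Local Notation O := (ringOfIntegers K).

Definition integer_embedding (i : 'I_n) : {rmorphism O -> R} :=
  sigma i \o (val : O -> K).

Definition modular_act (M : SL2 O) (z : 'rV[upper_half_plane R]_n) :
    'rV[upper_half_plane R]_n :=
  \row_i uhp_act (SL2_map (integer_embedding i) M) (z 0 i).

Lemma SL2_map1 (A B : comNzRingType) (f : {rmorphism A -> B}) :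
  SL2_map f 1%g = 1%g.
Proof. by apply: val_inj; rewrite /= map_mx1. Qed.

Lemma SL2_mapM (A B : comNzRingType) (f : {rmorphism A -> B}) M N :
  SL2_map f (M * N)%g = (SL2_map f M * SL2_map f N)%g.
Proof. by apply: val_inj; rewrite /= map_mxM. Qed.

Lemma modular_act1 z : modular_act 1%g z = z.
Proof. by apply/rowP => i; rewrite !mxE SL2_map1 uhp_act1. Qed.

Lemma modular_actM M N z :
  modular_act (M * N)%g z = modular_act M (modular_act N z).
Proof. by apply/rowP => i; rewrite !mxE SL2_mapM uhp_actM. Qed.

Lemma congruence_subgroup1 (A : comNzRingType) (I : ideal A) :
  congruence_subgroup I 1%g.
Proof. by move=> i j; rewrite subrr; exact: ideal0. Qed.

Lemma congruence_subgroupM (A : comNzRingType) (I : ideal A) M N :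
  congruence_subgroup I M -> congruence_subgroup I N ->
  congruence_subgroup I (M * N)%g.
Proof.
move=> hM hN i j.
have -> : val (M * N)%g i j - (1%:M : 'M[A]_2) i j =
    \sum_k val N k j * (val M i k - (1%:M : 'M[A]_2) i k) +
    (val N i j - (1%:M : 'M[A]_2) i j).
  rewrite (eq_bigr (fun k => val M i k * val N k j -
    (1%:M : 'M[A]_2) i k * val N k j)); last by move=> k _; ring.
  rewrite sumrB /= [in LHS]mxE.
  have := congr1 (fun X : 'M[A]_2 => X i j) (mul1mx (val N)); rewrite mxE => ->.
  by rewrite addrA subrK.
apply: idealD; last exact: hN.
elim/big_ind: _ => [|x y|k _]; [exact: ideal0|exact: idealD|].
exact/idealM/hM.
Qed.

Lemma congruence_subgroupV (A : comNzRingType) (I : ideal A) M :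
  congruence_subgroup I M -> congruence_subgroup I (M^-1)%g.
Proof.
move=> hM i j.
have -> : val (M^-1)%g i j - (1%:M : 'M[A]_2) i j =
    \sum_k (- val (M^-1)%g k j) * (val M i k - (1%:M : 'M[A]_2) i k).
  rewrite (eq_bigr (fun k => (1%:M : 'M[A]_2) i k * val (M^-1)%g k j -
    val M i k * val (M^-1)%g k j)); last by move=> k _; ring.
  rewrite sumrB.
  have := congr1 (fun X : 'M[A]_2 => X i j) (mul1mx (val (M^-1)%g)).
  rewrite mxE => ->.
  have := congr1 (fun X : SL2 A => val X i j) (mulgV M).
  by rewrite /= [in LHS]mxE => ->.
elim/big_ind: _ => [|x y|k _]; [exact: ideal0|exact: idealD|].
exact/idealM/hM.
Qed.

Variable I : ideal O.

Definition orbit_rel (z w : 'rV[upper_half_plane R]_n) : bool :=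
  `[< exists2 M, congruence_subgroup I M & w = modular_act M z >].

Lemma orbit_rel_equiv : equiv_class_of orbit_rel.
Proof.
split=> [z|z w|w z u].
- apply/asboolP; exists 1%g; first exact: congruence_subgroup1.
  by rewrite modular_act1.
- apply/asboolP/asboolP => -[M hM ->]; exists (M^-1)%g;
    by rewrite -?modular_actM ?mulVg ?modular_act1//; exact: congruence_subgroupV.
- move=> /asboolP[M hM ->] /asboolP[N hN ->]; apply/asboolP.
  by exists (N * M)%g; [exact: congruence_subgroupM|rewrite modular_actM].
Qed.

Definition orbit_equiv := EquivRelPack orbit_rel_equiv.

Definition congruence_quotient : Type :=
  quotient_topology {eq_quot orbit_equiv}.

Definition congruence_proj (z : 'rV[upper_half_plane R]_n) :
  congruence_quotient := \pi_{eq_quot orbit_equiv} z.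

(* The distance of the quotient metric is the distance between orbits. *)
Definition congruence_dist (p q : congruence_quotient) : R :=
  inf [set d | exists z w,
    [/\ congruence_proj z = p, congruence_proj w = q & d = prod_dist z w]].

End Quotient.
Arguments congruence_quotient {R K n} sigma I.
Arguments congruence_proj {R K n} sigma I z.
Arguments congruence_dist {R K n} sigma I p q.

(* Main.v *)
Require Import Defs.
From HB Require Import structures.
From mathcomp Require Import finmap complex ring lra zify.
From mathcomp Require Import all_boot all_order all_algebra all_field.
From mathcomp Require Import all_classical all_reals all_analysis.
Import Order.TTheory GRing.Theory Num.Theory.
Import numFieldNormedType.Exports.
Local Open Scope classical_set_scope.
Local Open Scope ring_scope.

(** Let N be the norm of I. Among the classes of 0, ..., N modulo I two must
    coincide, so I contains a positive integer m <= N, and Gamma(I) contains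
    the rational integer matrix A = [[1 + m^2, m], [m, 1]]. It is the same
    matrix under every embedding, it is hyperbolic, and it translates along
    its axis by 4 ln alpha with alpha = (m + sqrt (m^2 + 4)) / 2 <= m + 1. The
    diagonal axis in the product of n planes is translated by
    4 sqrt n ln alpha, hence its image in M_I is a closed curve of at most
    that length ([systole_le]). On the other side the unipotent matrices
    [[1, x], [0, 1]] and one Weyl element give at least N + 1 cosets
    ([ideal_norm_lt_index]), so alpha <= [Gamma : Gamma(I)], and
    sqrt n <= n^(3/2) concludes.

    It remains to see that this curve is a geodesic and is not contractible.
    Both follow from an injectivity radius at each point
    ([injectivity_radius]), that is, from the action being free and properly
    discontinuous. Proper discontinuity comes from the discreteness of O in
    R^n: an integer x with bounded conjugates has bounded integral traces
    Tr (x e_j) against an integral basis e, and these traces determine x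
    ([finite_bounded_integers]). Freeness comes from the size of N: a nonzero
    x in I whose conjugates are at most 4 in absolute value would bound N, as
    x O is contained in I and has a bounded fundamental domain
    ([large_norm_no_small_element]); but if M in Gamma(I) fixes a point, then
    tr M - 2 is an element of I of this size, hence 0, and a matrix of trace 2
    with a fixed point is 1.

    Non-contractibility ([not_contractible]) is homotopy lifting in discrete
    form. A homotopy is sampled on a fine grid, and a row of the grid is lifted
    to a chain with short steps from a point z to A z. A chain of this kind over
    one row can be moved to the next row, because below the injectivity radius
    a point of the quotient has only one lift near a given point. Over the last
    row, which is constant, the short steps are trivial, so A z = z, which is
    impossible. *)

Set Implicit Arguments.
Unset Strict Implicit.
Unset Printing Implicit Defensive.

(** * Finite sets *)

Lemma finite_set_injective_code (T : choiceType) (U : finType) (f : T -> U) (A : set T) :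
  {in A &, injective f} -> finite_set A.
Proof.
move=> finj; have : finite_set (f @` A) by exact: finite_finset.
by rewrite (eq_finite_set (inj_card_eq finj)).
Qed.

Lemma size_uniq_fset_set (T : choiceType) (A : set T) (s : seq T) :
  finite_set A -> uniq s -> {in s, forall x, A x} -> (size s <= #|` fset_set A|)%N.
Proof.
move=> fA us sA; apply: uniq_leq_size => // x xs.
by rewrite in_fset_set // inE; exact: sA.
Qed.

(** The minimum of finitely many positive radii is positive. *)
Lemma finite_common_radius (R : realType) (T : choiceType) (F : set T)
    (P : T -> R -> Prop) :
  finite_set F -> (forall x r s, s <= r -> P x r -> P x s) ->
  (forall x, F x -> exists2 r, 0 < r & P x r) ->
  exists2 r, 0 < r & forall x, F x -> P x r.
Proof.
move=> fF Pmono FP.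
have [r r0 rP] : exists2 r, 0 < r & {in (fset_set F : seq T), forall x, P x r}.
  have : {in (fset_set F : seq T), forall x, F x}.
    by move=> x; rewrite in_fset_set // => /set_mem.
  elim: (fset_set F : seq T) => [|x s IH] sF; first by exists 1.
  have [r1 r10 sP] := IH (fun y ys => sF y (mem_behead (s := x :: s) ys)).
  have [r2 r20 xP] := FP x (sF x (mem_head _ _)).
  exists (Num.min r1 r2); first by rewrite lt_min r10.
  move=> y; rewrite inE => /predU1P[->|/sP].
    by apply: Pmono xP; rewrite ge_min lexx orbT.
  by apply: Pmono; rewrite ge_min lexx.
by exists r => // x Fx; apply: rP; rewrite in_fset_set //; exact/mem_set.
Qed.

(** * Integral elements of number fields *)

(** A monic integral equation for q holds already in the rationals, hence also in the
    algebraic complex numbers, where [Cint_rat_Aint] applies. *)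
Lemma rat_integral_int (R : numFieldType) (q : rat) :
  integralOver (intr : int -> R) (ratr q) -> exists z : int, q = z%:~R.
Proof.
case=> p pmon proot.
have pq : root (map_poly (intr : int -> rat) p) q.
  rewrite -(fmorph_root (@ratr R)) -map_poly_comp.
  by rewrite (eq_map_poly (g := intr)) // => z /=; rewrite ratr_int.
have : (ratr q : algC) \in Aint.
  apply: (@root_monic_Aint (map_poly intr p)).
  - rewrite -(fmorph_root (@ratr algC)) -map_poly_comp in pq.
    by rewrite (eq_map_poly (g := intr)) // in pq => z /=; rewrite ratr_int.
  - exact: (monic_map (intr : {rmorphism int -> algC})) pmon.
  by apply/polyOverP => i; rewrite coef_map /= intr_int.
move=> /(Cint_rat_Aint (Crat_rat q)) /intrP [z qz].
by exists z; apply: (fmorph_inj (@ratr algC)); rewrite /= qz ratr_int.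
Qed.

Lemma int_closure_int (K : fieldExtType rat) (z : int) :
  (z%:~R : K) \in int_closure K.
Proof. exact: rpred_int. Qed.

(** If d clears the denominators of the minimal polynomial p of x, then d x is a root
    of the monic polynomial d^deg(p) p(X / d), whose coefficients are integral. *)
Lemma integral_multiple (K : fieldExtType rat) (x : K) :
  exists2 d : nat, (0 < d)%N & d%:R * x \in int_closure K.
Proof.
pose p := minPoly 1%AS x.
have pc i : {q : rat | p`_i = in_alg K q}.
  by apply: cid; have /polyOverP/(_ i)/vlineP[q ->] := minPolyOver 1%AS x; exists q.
pose d := (\prod_(i < size p) `|denq (sval (pc i))|)%N.
have dP i : (d%:R * p`_i : K) \in int_closure K.
  have [ip|ip] := ltnP i (size p); last by rewrite nth_default // mulr0 rpred0.
  have -> : d = (`|denq (sval (pc i))| *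
      \prod_(j < size p | j != Ordinal ip) `|denq (sval (pc j))|)%N.
    by rewrite /d (bigD1 (Ordinal ip)).
  rewrite natrM mulrAC; apply: rpredM; last exact: rpred_nat.
  case: (pc i) => q /= ->.
  rewrite -(rmorph_nat (in_alg K)) -rmorphM pmulrn absz_denq mulrC.
  rewrite -[q in q * _]divq_num_den divfK ?intr_eq0 ?denq_neq0 // rmorph_int.
  exact: int_closure_int.
have d_gt0 : (0 < d)%N.
  by rewrite /d prodn_gt0 // => i; rewrite absz_gt0 denq_neq0.
have dK : (d%:R : K) != 0.
  by rewrite -(rmorph_nat (in_alg K)) fmorph_eq0 pnatr_eq0 -lt0n.
exists d => //.
pose r := \poly_(i < size p) (p`_i * d%:R ^+ ((size p).-1 - i)).
have p0 : (0 < size p)%N by rewrite size_poly_gt0 monic_neq0 ?monic_minPoly.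
have rtop : r`_(size p).-1 = 1.
  rewrite coef_poly prednK // leqnn subnn expr0 mulr1.
  exact/monicP/monic_minPoly.
have sr : size r = size p.
  apply: size_poly_eq; rewrite subnn expr0 mulr1.
  by have /monicP := monic_minPoly 1%AS x; rewrite /lead_coef => ->; rewrite oner_neq0.
apply/asboolP; apply: (@integral_root_monic _ _ (intr : {rmorphism int -> K}) _ r).
- by apply/monicP; rewrite /lead_coef sr.
- rewrite /root horner_poly.
  rewrite (eq_bigr (fun i : 'I_(size p) => d%:R ^+ (size p).-1 * (p`_i * x ^+ i))).
    rewrite -mulr_sumr -horner_coef; have := root_minPoly 1%AS x.
    by rewrite /root => /eqP ->; rewrite mulr0.
  move=> i _; rewrite exprMn.
  have -> : d%:R ^+ (size p).-1 = d%:R ^+ ((size p).-1 - i) * d%:R ^+ i :> K.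
    by rewrite -exprD subnK // -ltnS prednK.
  by rewrite [p`_i * _]mulrC mulrACA.
apply/integral_poly => i; have : r`_i \in int_closure K; last by move/asboolP.
rewrite coef_poly; case: ifP => ip; last exact: rpred0.
have [->|ni] := eqVneq i (size p).-1.
  rewrite subnn expr0 mulr1.
  have /monicP := monic_minPoly 1%AS x; rewrite /lead_coef -/p => ->; exact: rpred1.
have -> : ((size p).-1 - i = ((size p).-1 - i).-1.+1)%N by lia.
rewrite exprS mulrA [p`_i * _]mulrC; apply: rpredM; first exact: dP.
exact/rpredX/rpred_nat.
Qed.
(** Shifting by C codes the integers of absolute value at most C by an ordinal. *)
Lemma bounded_int_code_inj (C : nat) (a b : int) : `|a| <= C%:Z -> `|b| <= C%:Z ->
  inord (absz (a + C%:Z)) = inord (absz (b + C%:Z)) :> 'I_(C + C).+1 -> a = b.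
Proof.
rewrite !ler_norml => /andP[a1 a2] /andP[b1 b2] /(congr1 val) /=.
rewrite !inordK.
- lia.
- lia.
- lia.
Qed.

(** * Discreteness of the ring of integers *)

Section NumberField.
Variables (R : realType) (K : fieldExtType rat) (n : nat).
Variable sigma : 'I_n -> {rmorphism K -> R}.
Hypothesis dimK : \dim {:K} = n.
Hypothesis sigma_inj : forall i j, sigma i =1 sigma j -> i = j.
Local Notation O := (ringOfIntegers K).

(** Dedekind's independence of characters: from a relation evaluated at y x one
    subtracts sigma_i0 y times the relation at x, which shortens it. *)
Lemma embeddings_independent (s : seq 'I_n) (c : 'I_n -> R) : uniq s ->
  (forall x, \sum_(i <- s) c i * sigma i x = 0) -> {in s, forall i, c i = 0}.
Proof.
elim: s c => [//|i0 s IH] c /= /andP[i0s us] h.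
have cs i : i \in s -> c i = 0.
  move=> si; have ni : i0 != i by apply: contraNneq i0s => ->.
  have [y ny] : exists y, sigma i y != sigma i0 y.
    apply/not_existsP => a; move/eqP: ni; apply; apply/esym/sigma_inj => y.
    by apply/eqP; apply/negPn/negP; exact: a.
  have := IH (fun i => c i * (sigma i y - sigma i0 y)) us _ i si.
  move=> /(_ _)/eqP; rewrite mulf_eq0 subr_eq0 (negbTE ny) orbF => a.
  apply/eqP; apply: a => x.
  have := h (y * x); have := congr1 (fun t => sigma i0 y * t) (h x).
  rewrite !big_cons mulr0 mulrDr rmorphM => e1 e2.
  rewrite (eq_bigr (fun i => c i * sigma i (y * x) - sigma i0 y * (c i * sigma i x))).
    rewrite sumrB -mulr_sumr; apply/eqP; rewrite subr_eq0; apply/eqP.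
    move: e1 e2; move: (\sum_(i <- s) _) (\sum_(i <- s) _) => S T e1 e2.
    by apply: (addrI (c i0 * (sigma i0 y * sigma i0 x))); rewrite e2 -e1; ring.
  by move=> k _; rewrite rmorphM; ring.
move=> i; rewrite inE => /orP[/eqP->|/cs //].
have := h 1; rewrite big_cons rmorph1 mulr1 big_seq big1 ?addr0 // => k ks.
by rewrite cs // mul0r.
Qed.

(** A rational basis of K, each vector being scaled into O. *)
Lemma integral_basis : exists e : 'I_n -> O,
  forall x : K, exists q : 'I_n -> rat, x = \sum_j q j *: (e j : K).
Proof.
rewrite -dimK; pose b := vbasis {:K}.
have dP j : {d : nat | (0 < d)%N && (d%:R * tnth b j \in int_closure K)}.
  by apply: cid; have [d d0 dP] := integral_multiple (tnth b j); exists d; rewrite d0.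
exists (fun j => RingOfIntegers (proj2 (andP (svalP (dP j))))) => x.
exists (fun j => coord b j x / (sval (dP j))%:R).
rewrite {1}(coord_vbasis (memvf x)); apply: eq_bigr => j _ /=.
rewrite mulr_natl -scaler_nat scalerA divfK ?(tnth_nth 0) //.
by rewrite pnatr_eq0 -lt0n; have /andP[] := svalP (dP j).
Qed.

Lemma natr_field_neq0 (L : fieldExtType rat) (d : nat) :
  ((d%:R : L) == 0) = (d == 0)%N.
Proof. by rewrite -(rmorph_nat (in_alg L)) fmorph_eq0 pnatr_eq0. Qed.

Let e := sval (cid integral_basis).
Let coordK x : {q : 'I_n -> rat | x = \sum_j q j *: (e j : K)}.
Proof. exact/cid/(svalP (cid integral_basis)). Qed.
Let E : 'M[R]_n := \matrix_(j, i) sigma i (val (e j)).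

Lemma sigma_sum (q : 'I_n -> rat) (f : 'I_n -> K) i :
  sigma i (\sum_j q j *: f j) = \sum_j ratr (q j) * sigma i (f j).
Proof. by rewrite rmorph_sum; apply: eq_bigr => j _; rewrite rmorphZ_num. Qed.

(** A linear relation between the columns of E is a relation between the embeddings
    on a basis, hence on K. *)
Lemma basis_matrix_unit : E \in unitmx.
Proof.
rewrite -unitmx_tr -row_free_unit; apply: inj_row_free => v vE.
apply/rowP => i; rewrite mxE.
apply: (@embeddings_independent (index_enum _) (v 0));
  rewrite ?index_enum_uniq ?mem_index_enum // => x.
have [q ->] := coordK x.
under eq_bigr do rewrite sigma_sum mulr_sumr.
rewrite exchange_big big1 // => j _.
have := congr1 (fun M : 'rV_n => M 0 j) vE; rewrite !mxE => vEj.
transitivity (ratr (q j) * \sum_i v 0 i * E^T i j); last by rewrite vEj mulr0.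
by rewrite mulr_sumr; apply: eq_bigr => k _; rewrite !mxE; ring.
Qed.

(** The matrix M of multiplication by y satisfies M E = E diag(sigma_i y), so the sum
    of the conjugates of y is the trace of the rational matrix M. *)
Lemma trace_rat (y : K) : exists q : rat, \sum_i sigma i y = ratr q.
Proof.
pose M := \matrix_(j, k) sval (coordK (y * val (e j))) k.
have ME : map_mx ratr M *m E = E *m diag_mx (\row_i sigma i y).
  apply/matrixP => j i; rewrite mul_mx_diag !mxE -rmorphM [_ * y]mulrC.
  rewrite (svalP (coordK (y * val (e j)))) sigma_sum.
  by apply: eq_bigr => k _; rewrite !mxE.
exists (\tr M); have := congr1 (fun A => \tr (A *m invmx E)) ME.
rewrite -mulmxA mulmxV ?basis_matrix_unit // mulmx1 mxtrace_mulC mulmxA.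
rewrite mulVmx ?basis_matrix_unit // mul1mx mxtrace_diag.
rewrite /mxtrace rmorph_sum /= => /esym; under eq_bigr do rewrite mxE.
by move=> ->; apply: eq_bigr => i _; rewrite mxE.
Qed.

Lemma trace_int (y : O) : exists z : int, \sum_i sigma i (val y) = z%:~R.
Proof.
have [q hq] := trace_rat y; have [z qz] : exists z : int, q = z%:~R.
  apply: (@rat_integral_int R); rewrite -hq.
  elim/big_ind: _ => [||i _].
  - exact: (mxpoly.integral0 (intr : {rmorphism int -> R})).
  - exact: (integral_add (RtoK := intr : {rmorphism int -> R})).
  have /asboolP[p pm pr] := valP y; exists p => //.
  rewrite -(fmorph_root (sigma i)) -map_poly_comp in pr.
  by rewrite (eq_map_poly (g := intr)) // in pr => k /=; rewrite rmorph_int.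
by exists z; rewrite hq qz ratr_int.
Qed.

Lemma degree_gt0 : (0 < n)%N.
Proof. by rewrite -dimK; exact: adim_gt0. Qed.

(** The integers x with bounded conjugates are coded by the bounded integers
    Tr (x e_j); the code is injective because E is invertible. *)
Lemma finite_bounded_integers (B : R) :
  finite_set [set x : O | forall i, `|sigma i (val x)| <= B].
Proof.
have tP x j : {z : int | \sum_i sigma i (val (x * e j)%R) = z%:~R}.
  by apply: cid; exact: (trace_int (x * e j)).
pose C := Num.bound (\sum_j \sum_i B * `|sigma i (val (e j))|).
pose f (x : O) : {ffun 'I_n -> 'I_(C + C).+1} :=
  [ffun j => inord (absz (sval (tP x j) + C%:Z))].
apply: (@finite_set_injective_code _ _ f) => x x' /set_mem xB /set_mem x'B fxx'.
have t_le (y : O) j : (forall i, `|sigma i (val y)| <= B) -> `|sval (tP y j)| <= C%:Z.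
  move=> yB; rewrite -(@ler_int R) intr_norm -(svalP (tP y j)).
  apply: le_trans (ler_norm_sum _ _ _) _.
  have B0 (i : 'I_n) : 0 <= B by exact: le_trans (normr_ge0 _) (yB i).
  apply: (@le_trans _ _ (\sum_j \sum_i B * `|sigma i (val (e j))|)).
    rewrite [leRHS](bigD1 j) //= ler_wpDr //.
      by apply: sumr_ge0 => k _; apply: sumr_ge0 => i _; rewrite mulr_ge0 // (B0 i).
    by apply: ler_sum => i _; rewrite rmorphM normrM ler_wpM2r.
  apply/ltW; apply: archi_boundP.
  by apply: sumr_ge0 => k _; apply: sumr_ge0 => i _; rewrite mulr_ge0 // (B0 i).
have tE j : sval (tP x j) = sval (tP x' j).
  have := congr1 (fun g : {ffun _ -> _} => g j) fxx'; rewrite !ffunE.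
  exact: bounded_int_code_inj (t_le x j xB) (t_le x' j x'B).
have dE : (\row_i sigma i (val x - val x')) *m E^T = 0.
  apply/rowP => j; rewrite !mxE.
  have := svalP (tP x j); rewrite tE -(svalP (tP x' j)) => /eqP.
  rewrite -subr_eq0 -sumrB => /eqP xx'; rewrite -[RHS]xx'.
  by apply: eq_bigr => i _; rewrite !mxE -rmorphM mulrBl rmorphB.
have E_free : row_free E^T by rewrite row_free_unit unitmx_tr basis_matrix_unit.
have /rowP/(_ (Ordinal degree_gt0)) := row_free_inj E_free (etrans dE (esym (mul0mx _ _))).
rewrite !mxE => /eqP; rewrite fmorph_eq0 subr_eq0 => /eqP xx'.
exact: val_inj.
Qed.

End NumberField.

(** * Ideals, cosets and the index of the congruence subgroup *)

Section Ideals.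
Variable A : comNzRingType.
Implicit Types (I : ideal A) (x y : A).

Definition ideal_coset I x : set A := [set x + y | y in ideal_set I].

Lemma idealN I x : I x -> I (- x).
Proof. by move=> Ix; rewrite -mulN1r; exact: idealM. Qed.

Lemma idealB I x y : I x -> I y -> I (x - y).
Proof. by move=> Ix Iy; apply: idealD => //; exact: idealN. Qed.

Lemma ideal_coset_eq I x y : ideal_coset I x = ideal_coset I y <-> I (x - y).
Proof.
split=> [exy|Ixy].
  have : ideal_coset I x x by exists 0; [exact: ideal0|rewrite addr0].
  by rewrite exy => -[z Iz <-]; rewrite addrC addKr.
apply/seteqP; split=> z [t It <-].
  by exists (x - y + t); [exact: idealD|rewrite addrA [y + _]addrC subrK].
exists (t - (x - y)); first exact: idealB.
by rewrite addrCA opprB [X in _ + X]addrCA subrr addr0 addrC.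
Qed.

Definition ideal_cosets I := [set ideal_coset I x | x in [set: A]].

Lemma ideal_cosetP I x : ideal_cosets I (ideal_coset I x).
Proof. by exists x. Qed.

Lemma ideal_cosets_finite I : (0 < ideal_norm I)%N -> finite_set (ideal_cosets I).
Proof.
move=> N0; apply: contrapT => nf; move: N0.
by rewrite /ideal_norm /fset_set; case: pselect => // _; rewrite cardfs0.
Qed.

(** Pigeonhole on the classes of 0, ..., N. *)
Lemma natr_in_ideal I : (0 < ideal_norm I)%N ->
  exists m : nat, [/\ (0 < m)%N, (m <= ideal_norm I)%N & I m%:R].
Proof.
move=> N0; pose f k := ideal_coset I k%:R; pose s := map f (iota 0 (ideal_norm I).+1).
have : ~~ uniq s.
  apply/negP => us; suff: (size s <= ideal_norm I)%N.
    by rewrite size_map size_iota ltnn.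
  apply: size_uniq_fset_set => //; first exact: ideal_cosets_finite.
  move=> C /mapP[k _ ->].
  exact: ideal_cosetP.
case/(uniqPn (f 0%N)) => i [j [ij]]; rewrite size_map size_iota => jN.
rewrite !(nth_map 0%N) ?size_iota // ?(ltn_trans ij) // !nth_iota // ?(ltn_trans ij) //.
rewrite !add0n => /esym/ideal_coset_eq Iij.
exists (j - i)%N; rewrite subn_gt0 ij natrB ?(ltnW ij) //; split=> //.
by rewrite (leq_trans (leq_subr _ _)).
Qed.

Definition subgroup_coset I (g : SL2 A) : set (SL2 A) :=
  [set (g * h)%g | h in congruence_subgroup I].

Lemma subgroup_coset_eq I g h :
  subgroup_coset I g = subgroup_coset I h <-> forall i j, I (val g i j - val h i j).
Proof.
have entry (a b : 'M[A]_2) (k : 'M[A]_2) : (forall i j, I (a i j - b i j)) ->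
    forall i j, I ((k *m a) i j - (k *m b) i j).
  move=> ab i j; rewrite -[X in _ + X]mulN1r !mxE mulN1r -sumrB.
  elim/big_ind: _ => [|x y|l _]; [exact: ideal0|exact: idealD|].
  by rewrite -mulrBr; exact: idealM.
have sub (g' h' : SL2 A) : (forall i j, I (val g' i j - val h' i j)) ->
    subgroup_coset I g' `<=` subgroup_coset I h'.
  move=> gh k [l Il <-]; exists (h'^-1 * g' * l)%g; last by rewrite !mulgA mulgV mul1g.
  apply: congruence_subgroupM => // i j.
  have -> : (1%:M : 'M[A]_2) = val (h'^-1)%g *m val h'.
    by have /(congr1 val) := mulVg h'.
  exact: (entry (val g') (val h')).
split=> [e|gh].
  have : subgroup_coset I g g by exists 1%g; [exact: congruence_subgroup1|rewrite mulg1].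
  rewrite e => -[k Ik <-] i j; rewrite -[val h in X in _ - X]mulmx1.
  exact: (entry (val k) 1%:M).
apply/seteqP; split; apply: sub => // i j; rewrite -opprB; exact: idealN.
Qed.

Definition subgroup_cosets I := [set subgroup_coset I g | g in [set: SL2 A]].

(** A coset of the congruence subgroup is determined by the classes of the four
    entries modulo I. *)
Lemma subgroup_cosets_finite I :
  (0 < ideal_norm I)%N -> finite_set (subgroup_cosets I).
Proof.
move=> N0; have fI := ideal_cosets_finite N0.
have rP C : {g : SL2 A | subgroup_cosets I C -> C = subgroup_coset I g}.
  apply: cid; have [[g _ <-]|nC] := pselect (subgroup_cosets I C).
    by exists g.
  by exists 1%g.
have inF x : ideal_coset I x \in fset_set (ideal_cosets I).
  by rewrite in_fset_set //; apply/mem_set; exact: ideal_cosetP.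
pose f C := [ffun ij : 'I_2 * 'I_2 => FSetSub (inF (val (sval (rP C)) ij.1 ij.2))].
apply: (@finite_set_injective_code _ _ f) => C D /set_mem IC /set_mem ID fCD.
rewrite (svalP (rP C)) // (svalP (rP D)) //; apply/subgroup_coset_eq => i j.
have /(congr1 val) := congr1 (fun g : {ffun _ -> _} => g (i, j)) fCD.
by rewrite !ffunE /= => /ideal_coset_eq.
Qed.

Definition mx22 (a b c d : A) : 'M[A]_2 :=
  \matrix_(i, j) if i == 0 then if j == 0 then a else b
                 else if j == 0 then c else d.

Lemma SL2_mx_subproof (a b c d : A) : a * d - b * c = 1 -> \det (mx22 a b c d) == 1.
Proof. by move=> e; rewrite det2 !mxE /= e. Qed.

Definition SL2_mx (a b c d : A) (e : a * d - b * c = 1) : SL2 A :=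
  exist (fun M : 'M[A]_2 => \det M == 1) (mx22 a b c d) (SL2_mx_subproof e).

(** The unipotent matrices with upper right entry in a transversal of O / I lie in
    distinct cosets, and the Weyl element lies in none of them. *)
Lemma ideal_norm_lt_index I :
  (1 < ideal_norm I)%N -> (ideal_norm I < group_index (congruence_subgroup I))%N.
Proof.
move=> N1; have N0 := ltnW N1; have fI := ideal_cosets_finite N0.
have I1 : ~ I 1.
  move=> I1; move: N1; rewrite /ideal_norm -/(ideal_cosets I).
  have -> : ideal_cosets I = [set ideal_coset I 0].
    apply/seteqP; split=> [C [x _ <-]|C ->] /=; last by exists 0.
    by apply/ideal_coset_eq; rewrite subr0 -[x]mulr1; exact: idealM.
  by rewrite fset_set1 cardfs1.
have rP C : {x : A | ideal_cosets I C -> C = ideal_coset I x}.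
  apply: cid; have [[x _ <-]|nC] := pselect (ideal_cosets I C).
    by exists x.
  by exists 0.
have eu x : 1 * 1 - x * 0 = 1 :> A by rewrite mulr0 subr0 mulr1.
have ew : 0 * 0 - -1 * 1 = 1 :> A by rewrite mulr0 mulr1 opprK add0r.
pose f C := subgroup_coset I (SL2_mx (eu (sval (rP C)))).
pose s := subgroup_coset I (SL2_mx ew) :: map f (fset_set (ideal_cosets I)).
have -> : (ideal_norm I).+1 = size s by rewrite /= size_map.
apply: size_uniq_fset_set; first exact: subgroup_cosets_finite.
- rewrite /= map_inj_in_uniq ?fset_uniq ?andbT.
    apply/negP => /mapP[C _] /subgroup_coset_eq/(_ 0 0).
    by rewrite !mxE /= sub0r => /idealN; rewrite opprK => /I1.
  move=> C D; rewrite !in_fset_set // !inE => IC ID /subgroup_coset_eq/(_ 0 1).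
  by rewrite !mxE /= => /ideal_coset_eq e; rewrite (svalP (rP C)) // (svalP (rP D)).
- by move=> C; rewrite inE => /orP[/eqP->|/mapP[D _ ->]]; eexists.
Qed.

End Ideals.

Section SmallElements.
Variables (R : realType) (K : fieldExtType rat) (n : nat).
Variable sigma : 'I_n -> {rmorphism K -> R}.
Hypothesis dimK : \dim {:K} = n.
Hypothesis sigma_inj : forall i j, sigma i =1 sigma j -> i = j.
Local Notation O := (ringOfIntegers K).

(** If x <> 0 lies in I, then subtracting integral multiples of the vectors x e_j, which
    form a basis of K, brings any y into the bounded set F without changing its
    class modulo I. So the norm of I is at most the cardinality of F, which depends
    on B only. *)
Lemma large_norm_no_small_element (B : R) : exists N : nat, forall I : ideal O,
  (N < ideal_norm I)%N ->
  forall x : O, I x -> (forall i, `|sigma i (val x)| <= B) -> x = 0.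
Proof.
have [e eP] := integral_basis dimK.
pose F := [set x : O | forall i,
  `|sigma i (val x)| <= \sum_i \sum_j B * `|sigma i (val (e j))|].
have fF : finite_set F by exact: finite_bounded_integers.
exists #|` fset_set F| => I; rewrite ltnNge => /negP NI x Ix xB.
apply/eqP/negPn/negP => x0; apply: NI.
suff -> : ideal_norm I = #|` fset_set (ideal_coset I @` F)|.
  by rewrite fset_set_image // leq_imfset_card.
congr #|` fset_set _|; apply/seteqP; split=> _ [y yF <-]; last by exists y.
have vx0 : val x != 0 by apply: contraNneq x0 => vx; apply/eqP/val_inj.
have [q yq] := eP (val y / val x).
pose y' := y - \sum_j ((Num.floor (q j))%:~R * e j) * x.
have vy' : val y' = val x * \sum_j (q j - (Num.floor (q j))%:~R) *: val (e j).
  have -> : val y' = val y - val x * \sum_j ((Num.floor (q j))%:~R *: val (e j)).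
    rewrite rmorphB rmorph_sum mulr_sumr; congr (_ - _); apply: eq_bigr => j _.
    by rewrite !rmorphM rmorph_int mulrC scaler_int mulrzl.
  under [in RHS]eq_bigr do rewrite scalerBl.
  by rewrite sumrB -yq mulrBr [_ * (_ / _)]mulrC divfK.
exists y'; last first.
  apply/ideal_coset_eq; rewrite /y' addrC addKr; apply: idealN.
  by elim/big_ind: _ => [|u v|j _]; [exact: ideal0|exact: idealD|exact: idealM].
move=> i; rewrite vy' rmorphM sigma_sum normrM.
have B0 (k : 'I_n) : 0 <= B by exact: le_trans (normr_ge0 _) (xB k).
rewrite [leRHS](bigD1 i) //= ler_wpDr //.
  by apply: sumr_ge0 => k _; apply: sumr_ge0 => j _; rewrite mulr_ge0 // (B0 i).
rewrite -mulr_sumr; apply: ler_pM => //.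
apply: le_trans (ler_norm_sum _ _ _) _; apply: ler_sum => j _.
rewrite normrM ler_piMl // ger0_norm ?ler0q ?subr_ge0 ?floor_le //.
rewrite -(rmorph1 (@ratr R)) ler_rat.
by rewrite lerBlDl -intrD1 ltW // floorD1_gt.
Qed.

End SmallElements.

(** * The inverse hyperbolic cosine *)

Section Arcosh.
Variable R : realType.
Implicit Types x y : R.

Lemma arcosh_arg_ge1 x : 1 <= x -> 1 <= x + Num.sqrt (x ^+ 2 - 1).
Proof. by move=> x1; rewrite (le_trans x1) // lerDl sqrtr_ge0. Qed.

Lemma expR_arcosh x : 1 <= x -> expR (arcosh x) = x + Num.sqrt (x ^+ 2 - 1).
Proof. by move=> x1; rewrite lnK // posrE (lt_le_trans ltr01) ?arcosh_arg_ge1. Qed.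

Lemma arcosh_ge0 x : 1 <= x -> 0 <= arcosh x.
Proof. by move=> x1; rewrite ln_ge0 // arcosh_arg_ge1. Qed.

Lemma le_expR_arcosh x : 1 <= x -> x <= expR (arcosh x).
Proof. by move=> x1; rewrite expR_arcosh // lerDl sqrtr_ge0. Qed.

Lemma ltr_arcosh x y : 1 <= x -> x < y -> arcosh x < arcosh y.
Proof.
move=> x1 xy; have y1 : 1 <= y by rewrite ltW // (le_lt_trans x1).
rewrite -ltr_expR !expR_arcosh // ltr_leD // ler_sqrt; nra.
Qed.

Lemma arcosh1 : arcosh (1 : R) = 0.
Proof. by rewrite /arcosh expr1n subrr sqrtr0 addr0 ln1. Qed.

Lemma arcosh_eq0 x : 1 <= x -> arcosh x = 0 -> x = 1.
Proof.
rewrite le_eqVlt => /predU1P[<-//|x1] a0.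
by have := ltr_arcosh (lexx 1) x1; rewrite a0 arcosh1 ltxx.
Qed.

Lemma arcosh_cosh (a : R) : arcosh ((expR a + expR (- a)) / 2) = `|a|.
Proof.
wlog a0 : a / 0 <= a.
  move=> h; have [/h //|/ltW] := leP 0 a.
  by rewrite -oppr_ge0 => /h; rewrite opprK normrN addrC.
rewrite ger0_norm // /arcosh.
have e1 : expR a * expR (- a) = 1 by rewrite -expRD subrr expR0.
have -> : ((expR a + expR (- a)) / 2) ^+ 2 - 1 = ((expR a - expR (- a)) / 2) ^+ 2.
  by rewrite -[X in _ - X]e1; field.
rewrite sqrtr_sqr ger0_norm; last first.
  by rewrite divr_ge0 // subr_ge0 ler_expR ge0_cp.
have -> : (expR a + expR (- a)) / 2 + (expR a - expR (- a)) / 2 = expR a by field.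
exact: expRK.
Qed.

(** The hypothesis bounds z by cosh (arcosh x + arcosh y). *)
Lemma arcosh_addition (x y z : R) : 1 <= x -> 1 <= y -> 1 <= z ->
  (z - x * y) ^+ 2 <= (x ^+ 2 - 1) * (y ^+ 2 - 1) ->
  arcosh z <= arcosh x + arcosh y.
Proof.
move=> x1 y1 z1 h.
set s := Num.sqrt (x ^+ 2 - 1); set t := Num.sqrt (y ^+ 2 - 1).
have s0 : 0 <= s by exact: sqrtr_ge0.
have t0 : 0 <= t by exact: sqrtr_ge0.
have s2 : s ^+ 2 = x ^+ 2 - 1 by rewrite sqr_sqrtr //; nra.
have t2 : t ^+ 2 = y ^+ 2 - 1 by rewrite sqr_sqrtr //; nra.
have zle : z <= x * y + s * t.
  rewrite -lerBlDl (le_trans (ler_norm _)) //.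
  rewrite -ler_sqr ?nnegrE ?mulr_ge0 // real_normK ?num_real //.
  by rewrite exprMn s2 t2.
rewrite -ler_expR expRD !expR_arcosh // -/s -/t.
have -> : (x + s) * (y + t) = (x * y + s * t) + (x * t + s * y) by ring.
rewrite lerD //.
have st0 : 0 <= x * t + s * y by rewrite addr_ge0 ?mulr_ge0 //; lra.
rewrite -[leRHS]ger0_norm // -sqrtr_sqr ler_sqrt ?sqr_ge0 //.
have -> : (x * t + s * y) ^+ 2 = (x * y + s * t) ^+ 2 - 1.
  by rewrite !sqrrD !exprMn s2 t2; ring.
have z0 : 0 <= z by lra.
by rewrite lerD2r ler_sqr // nnegrE // (le_trans z0 zle).
Qed.

End Arcosh.

(** * The hyperbolic plane *)

Section HyperbolicPlane.
Variable R : realType.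
Local Notation H := (upper_half_plane R).
Implicit Types (z w v : H) (M : SL2 R).

Definition uhp_re z : R := complex.Re (uhp_val z).
Definition uhp_im z : R := complex.Im (uhp_val z).

Lemma uhp_im_gt0 z : 0 < uhp_im z.
Proof. by case: z. Qed.

Lemma uhp_eq z w : uhp_re z = uhp_re w -> uhp_im z = uhp_im w -> z = w.
Proof.
by case: z w => [[x y] hz] [[x' y'] hw]; rewrite /uhp_re /uhp_im /= => e1 e2;
  apply: val_inj; rewrite /= e1 e2.
Qed.

Definition cosh_dist z w : R :=
  1 + ((uhp_re z - uhp_re w) ^+ 2 + (uhp_im z - uhp_im w) ^+ 2) /
      (2 * uhp_im z * uhp_im w).

Lemma uhp_distE z w : uhp_dist z w = arcosh (cosh_dist z w).
Proof.
rewrite /uhp_dist /cosh_dist /uhp_re /uhp_im.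
case: z w => [[x y] hz] [[x' y'] hw] /=.
by rewrite sqr_sqrtr // addr_ge0 ?sqr_ge0.
Qed.

Lemma cosh_dist_ge1 z w : 1 <= cosh_dist z w.
Proof.
rewrite lerDl divr_ge0 ?addr_ge0 ?sqr_ge0 //.
by rewrite !mulr_ge0 ?ltW ?uhp_im_gt0.
Qed.

Lemma uhp_dist_ge0 z w : 0 <= uhp_dist z w.
Proof. by rewrite uhp_distE arcosh_ge0 ?cosh_dist_ge1. Qed.

Lemma uhp_distxx z : uhp_dist z z = 0.
Proof. by rewrite uhp_distE /cosh_dist !subrr expr0n /= addr0 mul0r addr0 arcosh1. Qed.

Lemma uhp_distC z w : uhp_dist z w = uhp_dist w z.
Proof.
rewrite !uhp_distE /cosh_dist -[uhp_re w - _]opprB -[uhp_im w - _]opprB !sqrrN.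
by rewrite mulrAC.
Qed.

Lemma uhp_dist_eq0 z w : uhp_dist z w = 0 -> z = w.
Proof.
rewrite uhp_distE => /(arcosh_eq0 (cosh_dist_ge1 _ _)) /eqP.
rewrite /cosh_dist -subr_eq0 addrAC subrr add0r mulf_eq0 invr_eq0.
rewrite [X in _ || X]gt_eqF ?mulr_gt0 ?uhp_im_gt0 // orbF.
rewrite paddr_eq0 ?sqr_ge0 // !sqrf_eq0 !subr_eq0 => /andP[/eqP ? /eqP ?].
exact: uhp_eq.
Qed.

(** The difference of the two sides is the Gram determinant of three vectors of the
    hyperboloid model, which is the square of their determinant D. *)
Lemma cosh_dist_gram z w v :
  (cosh_dist z v - cosh_dist z w * cosh_dist w v) ^+ 2 <=
  (cosh_dist z w ^+ 2 - 1) * (cosh_dist w v ^+ 2 - 1).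
Proof.
have := uhp_im_gt0 z; have := uhp_im_gt0 w; have := uhp_im_gt0 v.
rewrite -subr_ge0 /cosh_dist.
move: (uhp_re z) (uhp_im z) (uhp_re w) (uhp_im w) (uhp_re v) (uhp_im v).
move=> x1 y1 x2 y2 x3 y3 y30 y20 y10.
set q1 := x1 ^+ 2 + y1 ^+ 2; set q2 := x2 ^+ 2 + y2 ^+ 2; set q3 := x3 ^+ 2 + y3 ^+ 2.
set D := ((x2 * q3 - x3 * q2) - (x1 * q3 - x3 * q1) + (x1 * q2 - x2 * q1)) /
  (2 * y1 * y2 * y3).
rewrite (_ : _ - _ = D ^+ 2) ?sqr_ge0 // /D /q1 /q2 /q3.
by field; rewrite !gt_eqF.
Qed.

Lemma uhp_dist_triangle w z v : uhp_dist z v <= uhp_dist z w + uhp_dist w v.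
Proof.
rewrite !uhp_distE; apply: arcosh_addition; rewrite ?cosh_dist_ge1 //.
exact: cosh_dist_gram.
Qed.

Definition mobius_den M z : R :=
  (val M 1 0 * uhp_re z + val M 1 1) ^+ 2 + (val M 1 0 * uhp_im z) ^+ 2.

Lemma mobius_den_gt0 M z : 0 < mobius_den M z.
Proof.
rewrite /mobius_den lt_def addr_ge0 ?sqr_ge0 // andbT paddr_eq0 ?sqr_ge0 //.
rewrite !sqrf_eq0; have := mobius_den_neq0 M z; case: z => [[x y] y0].
by rewrite eq_complex /uhp_re /uhp_im /= !mul0r subr0 !addr0.
Qed.

Lemma SL2_det M : val M 0 0 * val M 1 1 - val M 0 1 * val M 1 0 = 1.
Proof. by rewrite -det2; exact/eqP/(valP M). Qed.

Lemma uhp_act_im M z : uhp_im (uhp_act M z) = uhp_im z / mobius_den M z.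
Proof.
have := mobius_den_gt0 M z; have := SL2_det M.
rewrite /mobius_den /uhp_im /uhp_re /= /mobius; case: z => [[x y] /= y0].
move: (val M 0 0) (val M 0 1) (val M 1 0) (val M 1 1) => a b c d dt.
rewrite !mul0r !subr0 !addr0 => q0.
by rewrite -[X in _ = X / _]mul1r -dt; field; rewrite gt_eqF.
Qed.

Lemma uhp_act_re M z : uhp_re (uhp_act M z) =
  ((val M 0 0 * uhp_re z + val M 0 1) * (val M 1 0 * uhp_re z + val M 1 1) +
   val M 0 0 * val M 1 0 * uhp_im z ^+ 2) / mobius_den M z.
Proof.
have := mobius_den_gt0 M z.
rewrite /mobius_den /uhp_im /uhp_re /= /mobius; case: z => [[x y] /= y0].
move: (val M 0 0) (val M 0 1) (val M 1 0) (val M 1 1) => a b c d.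
rewrite !mul0r !subr0 !addr0 => q0.
by field; rewrite gt_eqF.
Qed.

Lemma uhp_dist_act M z w : uhp_dist (uhp_act M z) (uhp_act M w) = uhp_dist z w.
Proof.
rewrite !uhp_distE; congr arcosh; rewrite /cosh_dist !uhp_act_im !uhp_act_re.
have := mobius_den_gt0 M z; have := mobius_den_gt0 M w; have := SL2_det M.
have := uhp_im_gt0 z; have := uhp_im_gt0 w; rewrite /mobius_den.
move: (uhp_re z) (uhp_im z) (uhp_re w) (uhp_im w) => x y x' y'.
move: (val M 0 0) (val M 0 1) (val M 1 0) (val M 1 1) => a b c d y'0 y0 dt.
set q' := _ ^+ 2 + _; set q := _ ^+ 2 + _ => q'0 q0.
congr (1 + _).
have e : (((a * x + b) * (c * x + d) + a * c * y ^+ 2) * q' -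
          ((a * x' + b) * (c * x' + d) + a * c * y' ^+ 2) * q) ^+ 2 +
         ((a * d - b * c) * (y * q' - y' * q)) ^+ 2 =
         (a * d - b * c) ^+ 2 * ((x - x') ^+ 2 + (y - y') ^+ 2) * (q * q').
  by rewrite /q /q'; ring.
rewrite dt mul1r expr1n mul1r in e.
have -> : (x - x') ^+ 2 + (y - y') ^+ 2 =
    (((a * x + b) * (c * x + d) + a * c * y ^+ 2) * q' -
      ((a * x' + b) * (c * x' + d) + a * c * y' ^+ 2) * q) ^+ 2 / (q * q') +
    (y * q' - y' * q) ^+ 2 / (q * q').
  by rewrite -mulrDl e mulfK // mulf_neq0 ?gt_eqF.
move: e => _; move: (_ + a * c * _) (_ + a * c * _) => N N'.
by field; rewrite !gt_eqF.
Qed.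

(** The imaginary and real parts of (c z^2 + (d - a) z - b) / y, where y = Im z and
    M = [[a, b], [c, d]]. The numerator vanishes exactly at the fixed points of M,
    and its modulus controls how far M moves z. *)
Definition displ_im M z : R := 2 * val M 1 0 * uhp_re z + val M 1 1 - val M 0 0.
Definition displ_re M z : R :=
  (val M 1 0 * (uhp_re z ^+ 2 - uhp_im z ^+ 2)
   + (val M 1 1 - val M 0 0) * uhp_re z - val M 0 1) / uhp_im z.

Lemma cosh_dist_displacement M z :
  2 * (cosh_dist z (uhp_act M z) - 1) = displ_im M z ^+ 2 + displ_re M z ^+ 2.
Proof.
rewrite /cosh_dist uhp_act_im uhp_act_re /displ_im /displ_re.
have := mobius_den_gt0 M z; have := SL2_det M.
have := uhp_im_gt0 z; rewrite /mobius_den.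
move: (uhp_re z) (uhp_im z) => x y.
move: (val M 0 0) (val M 0 1) (val M 1 0) (val M 1 1) => a b c d y0 dt.
set q := _ ^+ 2 + _ => q0.
have e : (x * q - ((a * x + b) * (c * x + d) + a * c * y ^+ 2)) ^+ 2 +
         (y * q - (a * d - b * c) * y) ^+ 2 =
         ((y * (2 * c * x + d - a)) ^+ 2 +
          (c * (x ^+ 2 - y ^+ 2) + (d - a) * x - b) ^+ 2) * q.
  by rewrite /q; ring.
rewrite dt mul1r in e.
have -> : (2 * c * x + d - a) ^+ 2 + ((c * (x ^+ 2 - y ^+ 2) + (d - a) * x - b) / y) ^+ 2
  = ((x * q - ((a * x + b) * (c * x + d) + a * c * y ^+ 2)) ^+ 2 +
         (y * q - y) ^+ 2) / (y ^+ 2 * q).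
  rewrite e; move: (_ - b) => V; field; rewrite !gt_eqF //.
move: e => _; move: (_ + a * c * _) => N.
by field; rewrite !gt_eqF.
Qed.

(** Substituting the two displacement terms in (a + d)^2 = (d - a)^2 + 4 b c + 4 and
    completing the square in c. It bounds both c and the trace in terms of the
    displacement. *)
Lemma trace_displacement M z :
  (2 * val M 1 0 * uhp_im z + displ_re M z) ^+ 2 + (val M 0 0 + val M 1 1) ^+ 2 =
  displ_im M z ^+ 2 + displ_re M z ^+ 2 + 4.
Proof.
have := SL2_det M; have := uhp_im_gt0 z; rewrite /displ_im /displ_re.
move: (uhp_re z) (uhp_im z) => x y.
move: (val M 0 0) (val M 0 1) (val M 1 0) (val M 1 1) => a b c d y0 dt.
have -> : (4 : R) = 4 * (a * d - b * c) by rewrite dt mulr1.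
by field; rewrite gt_eqF.
Qed.

(** At a fixed point the displacement terms vanish, and [trace_displacement] becomes
    (2 c y)^2 + (a + d)^2 = 4. *)
Lemma fixed_point M z : uhp_act M z = z ->
  [/\ displ_im M z = 0, displ_re M z = 0,
      `|val M 0 0 + val M 1 1| <= 2 &
      val M 0 0 + val M 1 1 = 2 -> val M 1 0 = 0].
Proof.
move=> Mz; have := cosh_dist_displacement M z; have := trace_displacement M z.
have -> : cosh_dist z (uhp_act M z) = 1.
  by rewrite Mz /cosh_dist !subrr expr0n /= addr0 mul0r addr0.
rewrite subrr mulr0 => tr /esym/eqP.
rewrite paddr_eq0 ?sqr_ge0 // !sqrf_eq0 => /andP[/eqP u0 /eqP v0].
move: tr; rewrite u0 v0 expr0n /= !addr0 add0r => tr; split=> //.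
  rewrite -ler_sqr ?nnegrE // real_normK ?num_real //.
  by have := sqr_ge0 (2 * val M 1 0 * uhp_im z); lra.
move=> t2; move: tr; rewrite t2 => tr.
have : (2 * val M 1 0 * uhp_im z) ^+ 2 = 0 by lra.
move/eqP; rewrite sqrf_eq0 !mulf_eq0 pnatr_eq0 /=.
by rewrite [uhp_im z == 0]gt_eqF ?uhp_im_gt0 // orbF => /eqP.
Qed.

(** The entries a, b, c, d are linear combinations, with coefficients depending on z,
    of the displacement terms, the trace and 2 c y, all of which are bounded. *)
Lemma bounded_displacement z : exists B : R, forall M,
  uhp_dist z (uhp_act M z) < 1 -> forall i j, `|val M i j| <= B.
Proof.
(* cosh (dist) is at most exp (dist) < e, so the displacement terms satisfy
   U^2 + V^2 + 4 <= S; as S >= 1, a number with square at most S is at most S. *)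
pose S : R := 2 * expR 1 + 4; set x := uhp_re z; set y := uhp_im z.
have y0 : 0 < y := uhp_im_gt0 z.
have S1 : 1 <= S by rewrite /S; have := expR_ge0 (1 : R); lra.
have S0 : 0 <= S by lra.
pose T := S + S / y * `|x|.
have T0 : 0 <= T by rewrite addr_ge0 // mulr_ge0 ?divr_ge0 // ltW.
pose B := S / y + T + (S / y * (x ^+ 2 + y ^+ 2) + S * `|x| + S * y).
exists B => M; rewrite uhp_distE => hM.
have k1 : cosh_dist z (uhp_act M z) <= expR 1.
  apply: le_trans (le_expR_arcosh (cosh_dist_ge1 _ _)) _.
  by rewrite ler_expR ltW.
have := cosh_dist_displacement M z; have := trace_displacement M z.
have vy : displ_re M z * y = (val M 1 0 * (x ^+ 2 - y ^+ 2)
   + (val M 1 1 - val M 0 0) * x - val M 0 1) by rewrite divfK ?gt_eqF.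
move: vy; have : displ_im M z = 2 * val M 1 0 * x + val M 1 1 - val M 0 0 by [].
rewrite -/y; move: (displ_im M z) (displ_re M z) => U V.
move: k1 => + + +; move: (cosh_dist _ _) => k k1.
have pos1 : 0 <= S / y by rewrite divr_ge0 // ltW.
have pos2 : 0 <= S / y * (x ^+ 2 + y ^+ 2) by rewrite mulr_ge0 // addr_ge0 ?sqr_ge0.
have pos3 : 0 <= S * `|x| by rewrite mulr_ge0.
have pos4 : 0 <= S * y by rewrite mulr_ge0 // ltW.
suff all4 : U = 2 * val M 1 0 * x + val M 1 1 - val M 0 0 ->
    V * y = val M 1 0 * (x ^+ 2 - y ^+ 2) + (val M 1 1 - val M 0 0) * x - val M 0 1 ->
    (2 * val M 1 0 * y + V) ^+ 2 + (val M 0 0 + val M 1 1) ^+ 2 = U ^+ 2 + V ^+ 2 + 4 ->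
    2 * (k - 1) = U ^+ 2 + V ^+ 2 ->
    [/\ `|val M 0 0| <= B, `|val M 0 1| <= B, `|val M 1 0| <= B & `|val M 1 1| <= B].
  move=> a1 a2 a3 a4; have [b1 b2 b3 b4] := all4 a1 a2 a3 a4.
  by case=> [[|[|//]] hi] [[|[|//]] hj]; [move: b1|move: b2|move: b3|move: b4];
    congr (`|val M _ _| <= B); apply: val_inj.
move: (val M 0 0) (val M 0 1) (val M 1 0) (val M 1 1) => a b c d Ue Ve tr ke.
have sqS t : t ^+ 2 <= S -> `|t| <= S.
  move=> tS; rewrite -ler_sqr ?nnegrE // real_normK ?num_real //.
  by apply: le_trans tS _; rewrite expr2 ler_peMl.
have UV : U ^+ 2 + V ^+ 2 + 4 <= S by rewrite /S -ke; lra.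
have uS : `|U| <= S by apply: sqS; have := sqr_ge0 V; lra.
have vS : `|V| <= S by apply: sqS; have := sqr_ge0 U; lra.
have tS : `|a + d| <= S by apply: sqS; have := sqr_ge0 (2 * c * y + V); lra.
have cS : `|2 * c * y + V| <= S by apply: sqS; have := sqr_ge0 (a + d); lra.
have cy : `|c| <= S / y.
  rewrite ler_pdivlMr // -[y in _ * y]ger0_norm ?(ltW y0) // -normrM.
  by move: cS vS; rewrite !ler_norml => /andP[? ?] /andP[? ?]; apply/andP; split; lra.
have cx : `|c * x| <= S / y * `|x| by rewrite normrM ler_wpM2r.
have dT : `|d| <= T.
  have -> : d = (U + (a + d)) / 2 - c * x by rewrite Ue; field.
  move: uS tS cx; rewrite /T !ler_norml => /andP[? ?] /andP[? ?] /andP[? ?].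
  by apply/andP; split; lra.
have aT : `|a| <= T.
  have -> : a = ((a + d) - U) / 2 + c * x by rewrite Ue; field.
  move: uS tS cx; rewrite /T !ler_norml => /andP[? ?] /andP[? ?] /andP[? ?].
  by apply/andP; split; lra.
have bB : `|b| <= S / y * (x ^+ 2 + y ^+ 2) + S * `|x| + S * y.
  have -> : b = - (c * (x ^+ 2 + y ^+ 2)) + U * x - V * y by rewrite Ve Ue; ring.
  rewrite (le_trans (ler_normB _ _)) // lerD //; last first.
    by rewrite normrM (ger0_norm (ltW y0)) ler_wpM2r // ltW.
  rewrite (le_trans (ler_normD _ _)) // lerD //.
    have q0 : 0 <= x ^+ 2 + y ^+ 2 by rewrite addr_ge0 ?sqr_ge0.
    by rewrite normrN normrM (ger0_norm q0) ler_wpM2r.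
  by rewrite normrM ler_wpM2r.
by split; [move: aT|move: bB|move: cy|move: dT] => /le_trans; apply; rewrite /B; lra.
Qed.

Lemma uhp_ball_nbhs z (e : R) : 0 < e -> nbhs z [set w | uhp_dist z w < e].
Proof.
move=> e0; pose C : R := (expR e + expR (- e)) / 2.
have C1 : 1 < C.
  have e1 : expR e * expR (- e) = 1 by rewrite -expRD subrr expR0.
  have : 1 < expR e by rewrite expR_gt1.
  rewrite /C; move: e1; move: (expR e) (expR (- e)) => E F; nra.
have y0 := uhp_im_gt0 z.
(* If both coordinates move by less than y s, then Im w >= y / 2 and cosh_dist z w
   exceeds 1 by less than 2 s^2 < C - 1, where C = cosh e. *)
pose s : R := Num.min (1 / 2) ((C - 1) / 2).
have s0 : 0 < s by rewrite lt_min !divr_gt0 // subr_gt0.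
have s1 : s <= 1 / 2 by rewrite ge_min lexx.
have s2 : s <= (C - 1) / 2 by rewrite ge_min lexx orbT.
have sC : 2 * s ^+ 2 < C - 1 by nra.
have nb : nbhs (uhp_coord z) (ball (uhp_coord z) (uhp_im z * s)).
  by apply: nbhsx_ballx; rewrite mulr_gt0.
have nbz : nbhs z (@uhp_coord R @^-1` ball (uhp_coord z) (uhp_im z * s)).
  exact: (@initial_continuous _ _ (@uhp_coord R) z).
apply: filterS nbz => w [] /=.
rewrite /ball /= -/(uhp_re z) -/(uhp_re w) -/(uhp_im z) -/(uhp_im w) => hx hy.
rewrite uhp_distE -[e]gtr0_norm // -arcosh_cosh -/C.
apply: ltr_arcosh; first exact: cosh_dist_ge1.
rewrite /cosh_dist -ltrBrDl.
have y'0 := uhp_im_gt0 w.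
move: hx hy; rewrite !ltr_norml => /andP[x1 x2] /andP[y1 y2].
rewrite ltr_pdivrMr ?mulr_gt0 //.
move: (uhp_re z) (uhp_re w) (uhp_im z) (uhp_im w) y0 y'0 x1 x2 y1 y2 => x x' y y' *.
have dx : (x - x') ^+ 2 <= (y * s) ^+ 2 by nra.
have dy : (y - y') ^+ 2 <= (y * s) ^+ 2 by nra.
have y'h : y / 2 <= y' by nra.
have : y * y <= 2 * y * y' by nra.
have : 0 < y * y by nra.
rewrite exprMn in dx, dy; rewrite -!expr2 => yy yy'.
apply: le_lt_trans (lerD dx dy) _.
apply: (@lt_le_trans _ _ ((C - 1) * y ^+ 2)); first by nra.
by rewrite ler_wpM2l //; lra.
Qed.

End HyperbolicPlane.

(** * The action of the congruence subgroup *)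

Section CongruenceAction.
Variables (R : realType) (K : fieldExtType rat) (n : nat).
Variable sigma : 'I_n -> {rmorphism K -> R}.
Hypothesis dimK : \dim {:K} = n.
Hypothesis sigma_inj : forall i j, sigma i =1 sigma j -> i = j.
Local Notation O := (ringOfIntegers K).
Variable I : ideal O.
Hypothesis I_sparse :
  forall x : O, I x -> (forall i, `|sigma i (val x)| <= 4) -> x = 0.

Local Notation Hn := 'rV[upper_half_plane R]_n.
Local Notation act := (modular_act sigma).
Local Notation emb i M := (SL2_map (integer_embedding sigma i) M).
Implicit Types (z w : Hn) (M N : SL2 O).

Lemma embE i M j k : val (emb i M) j k = sigma i (val (val M j k)).
Proof. by rewrite mxE. Qed.

Lemma modular_actE M z i : act M z 0 i = uhp_act (emb i M) (z 0 i).
Proof. by rewrite mxE. Qed.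

(** By [fixed_point] the conjugates of the trace lie in [-2, 2], so tr M - 2, which is
    in I, has conjugates of absolute value at most 4 and vanishes. Then c = 0 in one
    embedding, hence in O, and the vanishing displacement terms give a = d and b = 0. *)
Lemma modular_act_free M z : congruence_subgroup I M -> act M z = z -> M = 1%g.
Proof.
move=> IM Mz.
have fixi i : uhp_act (emb i M) (z 0 i) = z 0 i by rewrite -modular_actE Mz.
pose i0 := Ordinal (degree_gt0 dimK).
have tr2 : val M 0 0 + val M 1 1 - 2 = 0.
  apply: I_sparse => [|i].
    have -> : val M 0 0 + val M 1 1 - 2 =
        (val M 0 0 - (1%:M : 'M[O]_2) 0 0) + (val M 1 1 - (1%:M : 'M[O]_2) 1 1).
      by rewrite !mxE /=; ring.
    by apply: idealD; exact: IM.
  have [_ _ + _] := fixed_point (fixi i); rewrite !embE.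
  rewrite !rmorphB !rmorph_nat !rmorphD => h.
  by rewrite (le_trans (ler_normB _ _)) // normr_nat; lra.
have tr : val M 0 0 + val M 1 1 = 2 by apply/eqP; rewrite -subr_eq0 tr2.
have [u0 v0 _ c0] := fixed_point (fixi i0).
have {}c0 : val M 1 0 = 0.
  have : sigma i0 (val (val M 1 0)) = 0.
    rewrite -embE; apply: c0; rewrite !embE -!rmorphD tr.
    by rewrite !rmorph_nat.
  by move/eqP; rewrite fmorph_eq0 => /eqP h; apply: val_inj.
have sinj (x y : O) : sigma i0 (val x) = sigma i0 (val y) -> x = y.
  by move/fmorph_inj/val_inj.
have da : val M 1 1 = val M 0 0.
  apply: sinj; move: u0; rewrite /displ_im !embE c0 !rmorph0 mulr0 mul0r add0r.
  by move/eqP; rewrite subr_eq0 => /eqP.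
have a1 : val M 0 0 = 1.
  apply: sinj; rewrite !rmorph1.
  have := congr1 (fun x : O => sigma i0 (val x)) tr; rewrite da !rmorph_nat !rmorphD.
  by move=> h; lra.
have b0 : val M 0 1 = 0.
  apply: sinj; rewrite !rmorph0.
  move: v0; rewrite /displ_re !embE c0 da !rmorph0 subrr !mul0r !add0r => /eqP.
  by rewrite mulf_eq0 invr_eq0 [X in _ || X]gt_eqF ?uhp_im_gt0 // orbF oppr_eq0 => /eqP.
apply/val_inj/matrixP => -[[|[|//]] hj] [[|[|//]] hk]; rewrite !mxE /=.
- by rewrite -[RHS]a1; congr (val M _ _); apply: val_inj.
- by rewrite -[RHS]b0; congr (val M _ _); apply: val_inj.
- by rewrite -[RHS]c0; congr (val M _ _); apply: val_inj.
- by rewrite -[RHS]a1 -da; congr (val M _ _); apply: val_inj.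
Qed.

(** The entries of such an M have bounded conjugates by [bounded_displacement], so they
    range over a finite set. *)
Lemma finite_small_displacement z :
  finite_set [set M : SL2 O | forall i, uhp_dist (z 0 i) (act M z 0 i) < 1].
Proof.
pose B i := sval (cid (bounded_displacement (z 0 i))).
have BP i M : uhp_dist (z 0 i) (act M z 0 i) < 1 ->
    forall j k, `|sigma i (val (val M j k))| <= B i.
  move=> h j k; rewrite -embE; apply: (svalP (cid (bounded_displacement (z 0 i)))).
  by rewrite -modular_actE.
pose C := \sum_i `|B i|.
have BC i : B i <= C.
  by rewrite (le_trans (ler_norm _)) // /C (bigD1 i) //= lerDl sumr_ge0.
have fC := finite_bounded_integers dimK sigma_inj C.
set F := [set x : O | _] in fC.
pose f M := [ffun jk : 'I_2 * 'I_2 =>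
  (insub (val M jk.1 jk.2) : option (fset_set F))].
apply: (@finite_set_injective_code _ _ f) => M N /set_mem sM /set_mem sN fMN.
apply/val_inj/matrixP => j k.
have := congr1 (fun g : {ffun _ -> _} => g (j, k)) fMN; rewrite !ffunE /=.
have inF L : (forall i, uhp_dist (z 0 i) (act L z 0 i) < 1) ->
    val L j k \in fset_set F.
  move=> sL; rewrite in_fset_set //; apply/mem_set => i.
  exact: le_trans (BP i L (sL i) j k) (BC i).
by rewrite !insubT ?inF // => ? ? /Some_inj/(congr1 val).
Qed.

(** Only finitely many M move every coordinate of z by less than 1, and none of them
    but 1 fixes z. *)
Lemma injectivity_radius z : exists2 r, 0 < r & forall M,
  congruence_subgroup I M -> M != 1%g -> exists i, r <= uhp_dist (z 0 i) (act M z 0 i).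
Proof.
pose P M r := congruence_subgroup I M -> M != 1%g ->
  exists i, r <= uhp_dist (z 0 i) (act M z 0 i).
have [r r0 rP] : exists2 r, 0 < r & forall M,
    [set M : SL2 O | forall i, uhp_dist (z 0 i) (act M z 0 i) < 1] M -> P M r.
  apply: finite_common_radius; first exact: finite_small_displacement.
    by move=> M r s sr + IM M1 => /(_ IM M1)[i ri]; exists i; exact: le_trans ri.
  move=> M _.
  have [[IM M1]|nM] := pselect (congruence_subgroup I M /\ M != 1%g); last first.
    by exists 1 => // IM M1; case: nM.
  have [i di] : exists i, uhp_dist (z 0 i) (act M z 0 i) != 0.
    apply: contrapT => /forallNP nd; move/eqP: M1; apply.
    apply: (modular_act_free (z := z)) => //; apply/rowP => i; apply/esym/uhp_dist_eq0.
    by apply/eqP/negPn/negP/nd.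
  exists (uhp_dist (z 0 i) (act M z 0 i)); last by move=> _ _; exists i.
  by rewrite lt_def di uhp_dist_ge0.
exists (Num.min r 1) => [|M IM M1]; first by rewrite lt_min r0 /=.
have [sM|/existsNP[i /negP]] :=
  pselect (forall i, uhp_dist (z 0 i) (act M z 0 i) < 1).
  have [i ri] := rP M sM IM M1; exists i.
  by rewrite (le_trans _ ri) // ge_min lexx.
by rewrite -leNgt => i1; exists i; rewrite (le_trans _ i1) // ge_min lexx orbT.
Qed.

Lemma modular_act_dist M z w i :
  uhp_dist (act M z 0 i) (act M w 0 i) = uhp_dist (z 0 i) (w 0 i).
Proof. by rewrite !modular_actE uhp_dist_act. Qed.

Lemma prod_dist_act M z w : prod_dist (act M z) (act M w) = prod_dist z w.
Proof.
by rewrite /prod_dist; congr Num.sqrt; apply: eq_bigr => i _; rewrite modular_act_dist.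
Qed.

Lemma prod_dist_ge z w i : uhp_dist (z 0 i) (w 0 i) <= prod_dist z w.
Proof.
rewrite -[leLHS]ger0_norm ?uhp_dist_ge0 // -sqrtr_sqr ler_sqrt.
  by rewrite (bigD1 i) //= lerDl sumr_ge0 // => j _; rewrite sqr_ge0.
by rewrite sumr_ge0 // => j _; rewrite sqr_ge0.
Qed.

End CongruenceAction.

(** * The quotient and its closed curves *)

Section CongruenceQuotient.
Variables (R : realType) (K : fieldExtType rat) (n : nat).
Variable sigma : 'I_n -> {rmorphism K -> R}.
Hypothesis dimK : \dim {:K} = n.
Hypothesis sigma_inj : forall i j, sigma i =1 sigma j -> i = j.
Local Notation O := (ringOfIntegers K).
Variable I : ideal O.
Hypothesis I_sparse :
  forall x : O, I x -> (forall i, `|sigma i (val x)| <= 4) -> x = 0.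

Local Notation Hn := 'rV[upper_half_plane R]_n.
Local Notation act := (modular_act sigma).
Local Notation X := (congruence_quotient sigma I).
Local Notation proj := (congruence_proj sigma I).
Implicit Types (z w : Hn) (M N : SL2 O).

Lemma proj_eqP z w :
  proj z = proj w <-> exists2 M, congruence_subgroup I M & w = act M z.
Proof.
split; first by move/(eqmodP (orbit_equiv sigma I)) => /asboolP.
by move=> zw; apply/(eqmodP (orbit_equiv sigma I))/asboolP.
Qed.

Lemma proj_act M z : congruence_subgroup I M -> proj (act M z) = proj z.
Proof. by move=> IM; apply/esym/proj_eqP; exists M. Qed.

Lemma proj_surj (p : X) : exists z, proj z = p.
Proof. by exists (repr p); rewrite /congruence_proj reprK. Qed.

(** Closeness in each coordinate rather than for the product distance: the triangle
    inequality of the hyperbolic plane is then enough. *)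
Definition close (d : R) z w := forall i, uhp_dist (z 0 i) (w 0 i) < d.

Lemma close_refl d z : 0 < d -> close d z z.
Proof. by move=> d0 i; rewrite uhp_distxx. Qed.

Lemma close_sym d z w : close d z w -> close d w z.
Proof. by move=> zw i; rewrite uhp_distC. Qed.

Lemma close_trans d e w z v : close d z w -> close e w v -> close (d + e) z v.
Proof.
by move=> zw wv i; apply: le_lt_trans (uhp_dist_triangle (w 0 i) _ _) _; exact: ltrD.
Qed.

Lemma close_act M d z w : close d (act M z) (act M w) <-> close d z w.
Proof. by split=> zw i; have := zw i; rewrite modular_act_dist. Qed.

Definition ball_image z d : set X := [set proj w | w in close d z].

(** The preimage of this set is the union of the translates of a ball, which are
    balls because the action is isometric. *)
Lemma ball_image_open z d : open (ball_image z d).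
Proof.
have : open (proj @^-1` ball_image z d); last by [].
rewrite openE => w [w0 zw0 /proj_eqP[M IM ->]].
pose P (i : 'I_1) (j : 'I_n) := [set v : upper_half_plane R |
  uhp_dist (act M w0 0 j) v < d - uhp_dist (z 0 j) (w0 0 j)].
exists P => [i j|v Pv].
  by rewrite (ord1 i); apply: uhp_ball_nbhs; rewrite subr_gt0; exact: zw0.
exists (act M^-1 v)%g; last by rewrite proj_act //; exact: congruence_subgroupV.
move=> i; apply: le_lt_trans (uhp_dist_triangle (w0 0 i) _ _) _.
have := Pv 0 i; rewrite /P /= ltrBrDl.
by rewrite -(modular_act_dist sigma M^-1%g (act M w0)) -modular_actM mulVg modular_act1.
Qed.

(** Stated for every lift of p, so that it depends on the point of the
    quotient only. *)
Definition injectivity_bound d (p : X) := forall z, proj z = p -> forall M,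
  congruence_subgroup I M -> M != 1%g ->
  exists i, d <= uhp_dist (z 0 i) (act M z 0 i).

(** M moves a lift N w as N^-1 M N moves w, and for w within r / 3 of z the latter
    displacement is at least r - 2 r / 3. *)
Lemma injectivity_bound_near z : exists2 d, 0 < d &
  forall p, ball_image z d p -> injectivity_bound d p.
Proof.
have [r r0 rP] := injectivity_radius dimK sigma_inj I_sparse z.
exists (r / 3); first by rewrite divr_gt0.
move=> _ [w zw <-] v /esym/proj_eqP[N IN ->] M IM M1.
have IM' : congruence_subgroup I (N^-1 * M * N)%g.
  by do 2?[apply: congruence_subgroupM => //]; exact: congruence_subgroupV.
have M'1 : (N^-1 * M * N)%g != 1%g.
  apply: contraNneq M1 => /(congr1 (fun g => N * g * N^-1)%g).
  by rewrite mulg1 mulgV !mulgA mulgV mul1g mulgK => ->.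
have [i ri] := rP _ IM' M'1; exists i.
have -> : uhp_dist (act N w 0 i) (act M (act N w) 0 i) =
    uhp_dist (w 0 i) (act (N^-1 * M * N)%g w 0 i).
  rewrite -[RHS](modular_act_dist sigma N) -!modular_actM.
  by rewrite !mulgA mulgV mul1g.
have := uhp_dist_triangle (w 0 i) (z 0 i) (act (N^-1 * M * N)%g z 0 i).
have := uhp_dist_triangle (act (N^-1 * M * N)%g w 0 i) (w 0 i)
  (act (N^-1 * M * N)%g z 0 i).
rewrite modular_act_dist [uhp_dist (w 0 i) (z 0 i)]uhp_distC.
by have := zw i; lra.
Qed.

Lemma injectivity_bound_eq d z w : injectivity_bound d (proj z) ->
  proj z = proj w -> close d z w -> z = w.
Proof.
move=> dz /proj_eqP[M IM ->] zw.
have [->|M1] := eqVneq M 1%g; first by rewrite modular_act1.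
by have [ i ] := dz z erefl M IM M1; rewrite leNgt zw.
Qed.

(** A one-sided form of closeness in the quotient: each lift of p has a lift of q
    nearby. *)
Definition lifts_close d (p q : X) := forall z, proj z = p ->
  exists2 w, proj w = q & close d z w.

Lemma lifts_close_ball z d p q :
  ball_image z (d / 2) p -> ball_image z (d / 2) q -> lifts_close d p q.
Proof.
move=> [u zu <-] [v zv <-] w /esym/proj_eqP[M IM ->].
exists (act M v); first exact: proj_act.
apply/close_act; rewrite [d]splitr; apply: close_trans zv.
exact: close_sym.
Qed.

Section Homotopy.
Variable h : R * R -> X.
Hypothesis h_cts : {within `[0, 1] `*` setT, continuous h}.
Let Q : set (R * R) := `[0, 1] `*` `[0, 1].

Lemma square_compact : compact Q.
Proof. by apply: compact_setX; exact: segment_compact. Qed.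

Lemma homotopy_near q (U : set X) : Q q -> open U -> U (h q) ->
  \forall q' \near q, Q q' -> U (h q').
Proof.
move=> [q1 q2] oU Uq.
have A : (`[0, 1] `*` setT) q by [].
have /subspace_continuousP/(_ q A) hq := h_cts.
have hU : nbhs q [set q' | (`[0, 1] `*` setT) q' -> U (h q')].
  by apply: hq; exact: open_nbhs_nbhs.
by apply: filterS hU => q' hq' [q'1 q'2]; exact: hq'.
Qed.

(** Compactness of the square turns the local bounds into a uniform one. *)
Lemma uniform_injectivity_bound :
  exists2 d, 0 < d & forall q, Q q -> injectivity_bound d (h q).
Proof.
have /near_covering_withinP cov := (compact_near_coveringP Q).1 square_compact.
have : \forall d \near 0^'+, Q `<=` [set q | injectivity_bound d (h q)].
  apply: (cov R (0^'+) (fun d q => injectivity_bound d (h q))) => q Qq.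
  have [z zq] := proj_surj (h q); have [r r0 rP] := injectivity_bound_near z.
  exists ([set q' | Q q' -> ball_image z r (h q')], [set d | d < r]).
    split; last exact: nbhs_right_lt.
    apply: homotopy_near => //; first exact: ball_image_open.
    by exists z => //; exact: close_refl.
  case=> q' d [/= hq' dr] Qq' w ww M IM M1.
  have [i ri] := rP _ (hq' Qq') w ww M IM M1.
  by exists i; rewrite (le_trans _ ri) // ltW.
move=> hd; have [d [d0 dP]] := filter_ex (filterI (nbhs_right_gt (0 : R)) hd).
by exists d.
Qed.

(** A Lebesgue number for the cover of the square by preimages of ball images. *)
Lemma uniform_lifts_close d : 0 < d -> exists2 e, 0 < e &
  forall q q', Q q -> Q q' -> ball q e q' -> lifts_close d (h q) (h q').
Proof.
move=> d0.
have /near_covering_withinP cov := (compact_near_coveringP Q).1 square_compact.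
have : \forall e \near 0^'+, Q `<=` [set q | forall q', Q q' -> ball q e q' ->
    lifts_close d (h q) (h q')].
  apply: (cov R (0^'+) (fun e q => forall q', Q q' -> ball q e q' ->
    lifts_close d (h q) (h q'))) => q Qq.
  have [z zq] := proj_surj (h q).
  have : \forall q' \near q, Q q' -> ball_image z (d / 2) (h q').
    apply: homotopy_near => //; first exact: ball_image_open.
    by exists z => //; apply: close_refl; rewrite divr_gt0.
  move=> /nbhs_ballP[r /= r0 rP].
  exists (ball q (r / 2), [set e | e < r / 2]).
    split; first by apply: nbhsx_ballx; rewrite divr_gt0.
    by apply: nbhs_right_lt; rewrite divr_gt0.
  case=> q1 e [/= qq1 er] Qq1 q2 Qq2 q1q2.
  apply: (lifts_close_ball (z := z)); apply: rP => //.
    by apply: le_ball qq1; rewrite ler_pdivrMr //; lra.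
  rewrite [r]splitr; apply: ball_triangle qq1 _.
  by apply: le_ball q1q2; exact: ltW.
move=> he; have [e [e0 eP]] := filter_ex (filterI (nbhs_right_gt (0 : R)) he).
by exists e => // q q' Qq; exact: eP.
Qed.

End Homotopy.

(** The predicate S j below says that the row j / N of the grid lifts to a chain with
    steps shorter than d from a point to its image under A. The row 0 is lifted by g
    itself, and d is a quarter of d4, an injectivity bound along the whole homotopy. *)
Lemma not_contractible (g : R -> Hn) (A : SL2 O) (L : R) :
  congruence_subgroup I A -> A != 1%g -> g 1 = act A (g 0) ->
  (forall s t i, uhp_dist (g s 0 i) (g t 0 i) <= L * `|s - t|) ->
  ~ contractible (fun t => proj (g t)).
Proof.
move=> IA A1 gA gL [h [p [h_cts h0 h1 hper]]].
have [d4 d40 injd] := uniform_injectivity_bound h_cts.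
pose d := d4 / 4; have d0 : 0 < d by rewrite divr_gt0.
have [e e0 lift] := uniform_lifts_close h_cts d0.
have [N [N0 Ne NL]] : exists N : nat, [/\ (0 < N)%N, N%:R^-1 < e & L * N%:R^-1 < d].
  pose N := (Num.bound (`|L| / d) + Num.bound e^-1).+1.
  exists N; split=> //.
    rewrite -[e]invrK ltf_pV2 ?posrE ?invr_gt0 //.
    have := archi_boundP (ltW (_ : 0 < e^-1)); rewrite invr_gt0 => /(_ e0) h'.
    by apply: lt_le_trans h' _; rewrite ler_nat leqW // leq_addl.
  rewrite ltr_pdivrMr // mulrC -ltr_pdivrMr //.
  apply: le_lt_trans (_ : `|L| / d < _).
    by rewrite ler_pM2r ?invr_gt0 // ler_norm.
  have := archi_boundP (_ : 0 <= `|L| / d); rewrite divr_ge0 ?(ltW d0) // => /(_ isT) h'.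
  by apply: lt_le_trans h' _; rewrite ler_nat leqW // leq_addr.
pose x (k : nat) : R := k%:R / N%:R.
have x_in k : (k <= N)%N -> `[0, 1]%classic (x k).
  move=> kN; rewrite /= in_itv /= /x divr_ge0 //=.
  by rewrite ler_pdivrMr ?ltr0n // mul1r ler_nat.
have x0 : x 0%N = 0 by rewrite /x mul0r.
have xN : x N = 1 by rewrite /x divff // pnatr_eq0 -lt0n.
have xS k : x k.+1 - x k = N%:R^-1.
  by rewrite /x -mulrBl -natrB // subSnn mul1r.
have xball k : ball (x k) e (x k.+1).
  by rewrite /ball /= distrC xS ger0_norm // invr_ge0.
pose S j := exists z : nat -> Hn,
  [/\ forall k, (k <= N)%N -> proj (z k) = h (x j, x k),
      forall k, (k < N)%N -> close d (z k) (z k.+1) & z N = act A (z 0%N)].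
have S0 : S 0%N.
  exists (fun k => g (x k)); split=> [k kN|k kN i|]; first by rewrite x0 h0.
    by apply: le_lt_trans (gL _ _ _) _; rewrite distrC xS ger0_norm // invr_ge0.
  by rewrite xN gA x0.
have SS j : (j < N)%N -> S j -> S j.+1.
  move=> jN [z [zh zc zA]].
  have wP k : {w | (k <= N)%N -> proj w = h (x j.+1, x k) /\ close d (z k) w}.
    apply: cid; have [kN|kN] := leqP k N; last by exists (z k).
    have [|||w w1 w2] := lift (x j, x k) (x j.+1, x k) _ _ _ (z k) (zh k kN).
    - by split; apply: x_in => //; exact: ltnW.
    - by split; apply: x_in.
    - by split => //=; exact: ballxx.
    - by exists w.
  (* The last point is imposed by the first one, to keep w N = A (w 0). *)
  pose w k := if (k < N)%N then sval (wP k) else act A (sval (wP 0%N)).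
  have wh k : (k <= N)%N -> proj (w k) = h (x j.+1, x k).
    rewrite /w => kN; have [kN'|Nk] := ltnP k N.
      by have [-> _] := svalP (wP k) kN.
    have -> : k = N by apply/eqP; rewrite eqn_leq kN.
    rewrite proj_act //; have [-> _] := svalP (wP 0%N) isT.
    rewrite xN x0; have := hper (x j.+1) (x_in _ jN) 0.
    by rewrite add0r => ->.
  have wz k : (k <= N)%N -> close d (z k) (w k).
    rewrite /w => kN; have [kN'|Nk] := ltnP k N.
      by have [_] := svalP (wP k) kN.
    have -> : k = N by apply/eqP; rewrite eqn_leq kN.
    rewrite zA; apply/close_act.
    by have [_] := svalP (wP 0%N) isT.
  exists w; split => // [k kN|]; last by rewrite /w ltnn N0.
  have [|||v v1 v2] := lift (x j.+1, x k) (x j.+1, x k.+1) _ _ _ (w k) (wh k (ltnW kN)).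
  - by split; apply: x_in => //; exact: ltnW.
  - by split; apply: x_in.
  - by split => //=; exact: ballxx.
  suff <- : v = w k.+1 by [].
  apply: (injectivity_bound_eq (d := d4)).
  - by rewrite v1; apply: injd; split; apply: x_in.
  - by rewrite v1 wh.
  (* v is reached from w k.+1 through w k, z k and z k.+1, each step below d *)
  have -> : d4 = d + d + d + d by rewrite /d; field.
  apply: close_trans (wz _ kN); apply: close_trans (zc _ kN).
  by apply: close_trans (close_sym (wz _ (ltnW kN))); exact: close_sym.
have [z [zh zc zA]] : S N.
  suff : forall j, (j <= N)%N -> S j by apply.
  by elim=> [//|j IH] jN; apply: SS => //; apply: IH; exact: ltnW.
have zp k : (k <= N)%N -> proj (z k) = p by move=> kN; rewrite zh // xN h1.
have inj1 : injectivity_bound d4 p.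
  by rewrite -(h1 0) -xN -x0; apply: injd; split; apply: x_in.
have z_cst k : (k <= N)%N -> z k = z 0%N.
  elim: k => [//|k IH] kN; rewrite -IH; last exact: ltnW.
  apply/esym/(injectivity_bound_eq (d := d4)).
  - by rewrite zp // ltnW.
  - by rewrite !zp // ltnW.
  - by move=> i; apply: lt_trans (zc k kN i) _; rewrite /d; lra.
have [ i ] := inj1 (z 0%N) (zp 0%N (leq0n _)) A IA A1.
by rewrite -zA z_cst // uhp_distxx leNgt d40.
Qed.

Lemma congruence_dist_le z w : congruence_dist sigma I (proj z) (proj w) <= prod_dist z w.
Proof.
apply: ge_inf; last by exists z, w.
by exists 0 => _ [z' [w' [_ _ ->]]]; exact: sqrtr_ge0.
Qed.

(** The distance of two orbits is an infimum over pairs of lifts; as the action is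
    isometric, one lift may be kept fixed. *)
Lemma congruence_dist_eq z w :
  (forall M, congruence_subgroup I M -> prod_dist z w <= prod_dist z (act M w)) ->
  congruence_dist sigma I (proj z) (proj w) = prod_dist z w.
Proof.
move=> zw; apply/eqP; rewrite eq_le congruence_dist_le /=.
apply: lb_le_inf; first by exists (prod_dist z w), z, w.
move=> _ [z' [w' [/esym/proj_eqP[M IM ->] /esym/proj_eqP[N IN ->] ->]]].
rewrite -(prod_dist_act sigma M^-1%g (act M z)) -!modular_actM mulVg modular_act1.
by apply: zw; apply: congruence_subgroupM => //; exact: congruence_subgroupV.
Qed.

End CongruenceQuotient.

(** * The axis of a hyperbolic matrix *)

Section Axis.
Variables (R : realType) (m : nat).
Hypothesis m_gt0 : (0 < m)%N.
Local Notation H := (upper_half_plane R).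

(** The attracting fixed point of [[1 + m^2, m], [m, 1]]; the other one is m - al, and
    al^2 is the larger eigenvalue. *)
Definition axis_end : R := (m%:R + Num.sqrt (m%:R ^+ 2 + 4)) / 2.
Local Notation al := axis_end.

Lemma axis_end_eq : al ^+ 2 = m%:R * al + 1.
Proof.
have m4 : 0 <= m%:R ^+ 2 + 4 :> R by rewrite addr_ge0 ?sqr_ge0.
have := sqr_sqrtr m4; rewrite /al; move: (Num.sqrt _) => s s2.
have -> : ((m%:R + s) / 2) ^+ 2 = (m%:R ^+ 2 + 2 * m%:R * s + s ^+ 2) / 4 :> R by field.
by rewrite s2; field.
Qed.

Lemma axis_end_gt1 : 1 < al.
Proof.
have m1 : 1 <= m%:R :> R by rewrite ler1n.
have : 1 < Num.sqrt (m%:R ^+ 2 + 4) :> R.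
  rewrite -[X in X < _]sqrtr1 ltr_sqrt; have := sqr_ge0 (m%:R : R); lra.
by rewrite /al; lra.
Qed.

Lemma axis_end_le : al <= m.+1%:R.
Proof.
rewrite leNgt; apply/negP => h; have := axis_end_eq; have := axis_end_gt1.
by move: h; rewrite -natr1; have : 0 <= m%:R :> R by []; move: (m%:R : R) al => M a; nra.
Qed.

(** The translation length: the matrix acts on its axis as z -> al^4 z acts on the
    imaginary half-line. *)
Definition axis_speed : R := 4 * ln al.
Local Notation l := axis_speed.

Lemma axis_speed_ge0 : 0 <= l.
Proof. by rewrite mulr_ge0 // ln_ge0 // ltW // axis_end_gt1. Qed.

Lemma expR_axis_speed : expR l = al ^+ 4.
Proof. by rewrite /l expRM_natl lnK // posrE (lt_trans ltr01) ?axis_end_gt1. Qed.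

Lemma vertical_subproof (t : R) : 0 < complex.Im (Complex 0 (expR (l * t))).
Proof. exact: expR_gt0. Qed.

Definition vertical (t : R) : H := UpperHalfPlane (vertical_subproof t).

Lemma vertical_dist s t : uhp_dist (vertical s) (vertical t) = l * `|s - t|.
Proof.
rewrite uhp_distE /cosh_dist /uhp_re /uhp_im /= subrr expr0n /= add0r.
have -> : l * `|s - t| = `|l * s - l * t|.
  by rewrite -mulrBr normrM [X in _ = X * _]ger0_norm ?axis_speed_ge0.
rewrite -arcosh_cosh; congr arcosh.
rewrite opprB !expRB; have := expR_gt0 (l * s); have := expR_gt0 (l * t).
by move: (expR (l * s)) (expR (l * t)) => a b b0 a0; field; rewrite !gt_eqF.
Qed.

Let D := 2 * al - m%:R.

Let D_gt0 : 0 < D.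
Proof.
rewrite /D; have := axis_end_eq; have := axis_end_gt1.
by move: al (m%:R : R) => a M; nra.
Qed.

Lemma axis_frame_subproof : al * D^-1 - (m%:R - al) / D * 1 = 1.
Proof.
rewrite mulr1 -mulrBl (_ : al - (m%:R - al) = D); last by rewrite /D; ring.
by rewrite divff // gt_eqF.
Qed.

Lemma axis_diag_subproof : al ^+ 2 * (al ^+ 2)^-1 - 0 * 0 = 1.
Proof.
by rewrite mulr0 subr0 divff // expf_neq0 // gt_eqF // (lt_trans ltr01) ?axis_end_gt1.
Qed.

Lemma axis_elt_subproof (A : comNzRingType) :
  (1 + m%:R ^+ 2) * 1 - m%:R * m%:R = 1 :> A.
Proof. by rewrite mulr1 -expr2 addrK. Qed.

Definition axis_elt (A : comNzRingType) : SL2 A := SL2_mx (axis_elt_subproof A).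
(** Maps 0 and infinity to the fixed points m - al and al, hence the imaginary
    half-line to the axis. *)
Definition axis_frame : SL2 R := SL2_mx axis_frame_subproof.
Definition axis_diag : SL2 R := SL2_mx axis_diag_subproof.

Lemma axis_elt_frame : (axis_elt R * axis_frame = axis_frame * axis_diag)%g.
Proof.
have e := axis_end_eq; have D0 := D_gt0; have a1 := axis_end_gt1.
have a0 : al != 0 by rewrite gt_eqF // (lt_trans ltr01).
apply/val_inj/matrixP => i j; rewrite !mxE !big_ord_recl !big_ord0 !mxE /=.
rewrite /D in D0 *; move: (m%:R : R) e D0 => M e D0.
have ab : al * (al - M) = 1 by rewrite mulrBr -expr2 e; ring.
have b2 : (al - M) ^+ 2 = 1 - M * (al - M) by rewrite sqrrB e; ring.
have ai : (al ^+ 2)^-1 = (al - M) ^+ 2.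
  have a2 : al ^+ 2 != 0 by rewrite expf_neq0.
  by apply: (mulfI a2); rewrite mulfV // -exprMn ab expr1n.
case: i j => [[|[|//]] hi] [[|[|//]] hj] /=; rewrite ?mulr0 ?mul1r ?mulr1 ?addr0 ?add0r.
- have -> : al * al ^+ 2 = M * al ^+ 2 + al by rewrite {1}e; ring.
  by rewrite e; ring.
- rewrite mulrA [RHS]mulrAC -mulrDl ai b2; congr (_ / _).
  have -> : (M - al) * (1 - M * (al - M)) = (M - al) + M * (al - M) ^+ 2 by ring.
  by rewrite b2; ring.
- by rewrite e.
- by rewrite mulrA -[X in _ + X]mul1r -mulrDl [RHS]mulrC ai b2; congr (_ / _); ring.
Qed.

Definition axis (t : R) : H := uhp_act axis_frame (vertical t).

Lemma axis_dist s t : uhp_dist (axis s) (axis t) = l * `|s - t|.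
Proof. by rewrite uhp_dist_act vertical_dist. Qed.

Lemma axis_diag_act t : uhp_act axis_diag (vertical t) = vertical (t + 1).
Proof.
have a0 : al != 0 by rewrite gt_eqF // (lt_trans ltr01) ?axis_end_gt1.
apply: uhp_eq; rewrite ?uhp_act_re ?uhp_act_im /mobius_den !mxE /= /uhp_re /uhp_im /=.
  by rewrite !(mulr0, mul0r, addr0).
rewrite mulrDr mulr1 expRD expR_axis_speed.
by move: (expR _) => E; field.
Qed.

Lemma axis_act t : uhp_act (axis_elt R) (axis t) = axis (t + 1).
Proof. by rewrite /axis -axis_diag_act -!uhp_actM axis_elt_frame. Qed.

End Axis.

(** * The closed geodesic *)

Section ClosedGeodesic.
Variables (R : realType) (K : fieldExtType rat) (n : nat).
Variable sigma : 'I_n -> {rmorphism K -> R}.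
Hypothesis dimK : \dim {:K} = n.
Hypothesis sigma_inj : forall i j, sigma i =1 sigma j -> i = j.
Local Notation O := (ringOfIntegers K).
Variable I : ideal O.
Hypothesis I_sparse :
  forall x : O, I x -> (forall i, `|sigma i (val x)| <= 4) -> x = 0.
Variable m : nat.
Hypothesis m_gt0 : (0 < m)%N.
Hypothesis I_m : I m%:R.

Local Notation Hn := 'rV[upper_half_plane R]_n.
Local Notation act := (modular_act sigma).
Local Notation proj := (congruence_proj sigma I).
Local Notation l := (axis_speed R m).
Local Notation A := (axis_elt m O).

Definition diagonal_axis (t : R) : Hn := \row_i axis m_gt0 t.
Local Notation g := diagonal_axis.
Let v := Num.sqrt n%:R * l.

Lemma congruence_axis_elt : congruence_subgroup I A.
Proof.
have Im2 : I (m%:R ^+ 2) by rewrite expr2; exact: idealM.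
by move=> [[|[|//]] hi] [[|[|//]] hj]; rewrite !mxE /= ?subr0 ?subrr //;
  [rewrite addrC addKr|exact: ideal0].
Qed.

Lemma axis_elt_neq1 : A != 1%g.
Proof.
apply/eqP => /(congr1 (fun M : SL2 O => val M 1 0)); rewrite !mxE /= => m0.
have /eqP : m%:R = 0 :> K by rewrite -(rmorph_nat (val : {rmorphism O -> K})) m0 rmorph0.
by rewrite natr_field_neq0; lia.
Qed.

Lemma diagonal_axis_act t : act A (g t) = g (t + 1).
Proof.
apply/rowP => i; rewrite !mxE -axis_act; congr uhp_act.
apply/val_inj/matrixP => j k; rewrite !mxE.
by do 2?case: ifP => _; rewrite ?rmorphD ?rmorphXn ?rmorph1 ?rmorph_nat.
Qed.

Lemma diagonal_axis_dist s t i : uhp_dist (g s 0 i) (g t 0 i) = l * `|s - t|.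
Proof. by rewrite !mxE axis_dist. Qed.

Lemma diagonal_axis_prod_dist s t : prod_dist (g s) (g t) = v * `|s - t|.
Proof.
rewrite /prod_dist (eq_bigr (fun=> (l * `|s - t|) ^+ 2)); last first.
  by move=> i _; rewrite diagonal_axis_dist.
have d0 : 0 <= l * `|s - t| by rewrite mulr_ge0 // axis_speed_ge0.
by rewrite sumr_const card_ord -mulr_natl sqrtrM ?ler0n // sqrtr_sqr ger0_norm // mulrA.
Qed.

Lemma speed_le : l <= v.
Proof.
rewrite /v ler_peMl ?axis_speed_ge0 // -[leLHS]sqrtr1 ler_sqrt ?ler0n //.
by rewrite ler1n (degree_gt0 dimK).
Qed.

Lemma speed_ge0 : 0 <= v.
Proof. by rewrite mulr_ge0 ?sqrtr_ge0 ?axis_speed_ge0. Qed.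

Lemma closed_diagonal_axis : closed_curve (fun t => proj (g t)).
Proof.
by move=> t; rewrite -diagonal_axis_act proj_act //; exact: congruence_axis_elt.
Qed.

(** Let r be an injectivity radius at g t. For x and y near t and M <> 1, some
    coordinate of M (g y) is at distance at least r / 2 from that of g x, which
    exceeds the distance from g x to g y. So the distance between the images in the
    quotient is the distance upstairs. *)
Lemma geodesic_diagonal_axis :
  geodesic (congruence_dist sigma I) (fun t => proj (g t)).
Proof.
exists v; first exact: speed_ge0.
move=> t; have [r r0 rP] := injectivity_radius dimK sigma_inj I_sparse (g t).
have v0 := speed_ge0; have lv := speed_le.
have l0 : 0 <= l := axis_speed_ge0 R m_gt0.
pose e := r / (4 * (v + 1)).
have e0 : 0 < e by rewrite divr_gt0 // mulr_gt0 // ltr_wpDl.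
have re : r = 4 * (v + 1) * e by rewrite /e mulrC divfK // gt_eqF // mulr_gt0 // ltr_wpDl.
exists (ball t e, ball t e).
  by split; exact: nbhsx_ballx.
case=> x y [/= tx ty].
rewrite (congruence_dist_eq (sigma := sigma)) ?diagonal_axis_prod_dist // => M IM.
have [->|M1] := eqVneq M 1%g; first by rewrite modular_act1 diagonal_axis_prod_dist.
have [ i ri] := rP M IM M1.
apply: le_trans (prod_dist_ge _ _ i).
have := uhp_dist_triangle (g x 0 i) (g t 0 i) (act M (g t) 0 i).
have := uhp_dist_triangle (act M (g y) 0 i) (g x 0 i) (act M (g t) 0 i).
rewrite modular_act_dist !diagonal_axis_dist.
move: tx ty; rewrite /ball /= => tx ty.
have xy : `|x - y| <= `|t - x| + `|t - y|.
  by rewrite (distrC t x) (le_trans _ (ler_normD _ _)) // addrA subrK.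
move: ri; rewrite (distrC y t) re.
move: (uhp_dist _ _) (uhp_dist _ _) (uhp_dist _ _) => d1 d2 d3.
move: tx ty xy; move: `|t - x| `|t - y| `|x - y| (normr_ge0 (t - x)) (normr_ge0 (t - y)).
by move=> a b c a0 b0; nra.
Qed.

Lemma diagonal_axis_length :
  (curve_length (congruence_dist sigma I) 0 1 (fun t => proj (g t)) <= v%:E)%E.
Proof.
apply: ge_ereal_sup => _ [s [ps /eqP ls] <-]; rewrite lee_fin /variation_dist.
set F := nth 1 (0 :: s).
have Fmono k : (k < size s)%N -> F k <= F k.+1.
  by move=> ks; apply/ltW; apply: (pathP 1 ps).
apply: (@le_trans _ _ (\sum_(0 <= k < size s) v * (F k.+1 - F k))).
  rewrite !big_nat; apply: ler_sum => k /andP[_ ks].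
  apply: le_trans (congruence_dist_le _ _ _ _) _.
  by rewrite diagonal_axis_prod_dist distrC ger0_norm ?subr_ge0 ?Fmono.
rewrite -mulr_sumr telescope_sumr // /F /= -[size s]/((size (0 :: s)).-1) nth_last /=.
by rewrite ls subr0 mulr1.
Qed.

Lemma systole_le : (systole (congruence_dist sigma I) <= v%:E)%E.
Proof.
apply: le_trans diagonal_axis_length; apply: ereal_inf_lbound.
exists (fun t => proj (g t)) => //; split.
- exact: closed_diagonal_axis.
- exact: geodesic_diagonal_axis.
apply: (not_contractible dimK sigma_inj I_sparse (L := l)
  congruence_axis_elt axis_elt_neq1).
  by rewrite diagonal_axis_act add0r.
by move=> s t i; rewrite diagonal_axis_dist.
Qed.

End ClosedGeodesic.

Unset Implicit Arguments.
Set Strict Implicit.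

Theorem mainTheorem2 (R : realType) (K : fieldExtType rat) (n : nat)
    (sigma : 'I_n -> {rmorphism K -> R})
    (I : nat -> ideal (ringOfIntegers K)) :
  \dim {:K} = n ->
  totally_real R K ->
  real_embeddings sigma ->
  (forall k, nonzero_ideal (I k)) ->
  ideal_norm (I k) @[k --> \oo] --> \oo ->
  \forall k \near \oo,
    (systole (congruence_dist sigma (I k)) <=
     (4 * n%:R `^ (3 / 2) *
      ln (group_index (congruence_subgroup (I k)))%:R)%:E)%E.
Proof.
move=> dimK _ [sigma_inj _] _ normI.
have [N NP] := large_norm_no_small_element dimK sigma_inj 4.
have : \forall k \near \oo, (N.+1 < ideal_norm (I k))%N.
  exact: (normI _ (nbhs_infty_gt N.+1)).
apply: filterS => k Nk.
have [m [m_gt0 mN Im]] := natr_in_ideal (leq_ltn_trans (leq0n _) Nk).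
have sparse := NP (I k) (ltnW Nk).
apply: le_trans (systole_le dimK sigma_inj sparse m_gt0 Im) _.
have idx : (m.+1 <= group_index (congruence_subgroup (I k)))%N.
  apply: leq_ltn_trans mN _; apply: ideal_norm_lt_index.
  exact: leq_ltn_trans Nk.
have n_gt0 := degree_gt0 dimK.
rewrite lee_fin /axis_speed mulrCA -mulrA ler_pM2l //.
have a1 := axis_end_gt1 R m_gt0.
apply: ler_pM; rewrite ?sqrtr_ge0 ?ln_ge0 // ?(ltW a1) //.
  by rewrite -powR12_sqrt ?ler0n // ler_powR ?ler1n //; lra.
rewrite ler_ln ?posrE ?(lt_trans ltr01 a1) ?ltr0n ?(leq_trans _ idx) //.
by rewrite (le_trans (axis_end_le R m_gt0)) // ler_nat.
Qed.
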